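(* Let $T\colon \mathbb{R}^d\times \mathcal{X}\to \mathcal{X}$ be a continuous action of $\mathbb{R}^d$ on a nonempty compact metrizable space $\mathcal{X}$. Let $\mathbf{d}$ be a metric on $\mathcal{X}$ compatible with the topology and $\varphi\colon \mathcal{X}\to \mathbb{R}$ a continuous function. Then $$\mathrm{mdim}(\mathcal{X}, T, \varphi) \leq \underline{\mathrm{mdim}}_{\mathrm{H},L^1}(\mathcal{X}, T, \mathbf{d}, \varphi).$$
   Context: Conventions. $d\ge 1$ is a natural number; $du$ denotes Lebesgue measure on $\mathbb{R}^d$. We write $T^u x=T(u,x)$, with $T^{u+v}=T^uT^v$, $T^0=\mathrm{id}$. The limits below may be infinite. Mean dimension with potential. Simplicial complexes are finite. For a finite simplicial complex $P$ and $a\in P$ the local dimension $\dim_a P$ is the maximum of $\dim\Delta$ over simplices $\Delta$ of $P$ containing $a$. For a compact metric space $(\mathcal{X},\mathbf{d})$ and $\varepsilon>0$, a continuous map $f\colon\mathcal{X}\to\mathcal{Y}$ to a topological space is an $\varepsilon$-embedding if $\mathrm{Diam}\, f^{-1}(y)<\varepsilon$ for all $y\in\mathcal{Y}$ (the empty set has diameter $0$). For continuous $\varphi\colon\mathcal{X}\to\mathbb{R}$, $$\mathrm{Widim}_\varepsilon(\mathcal{X},\mathbf{d},\varphi)=\inf\Big\{\max_{x\in\mathcal{X}}\big(\dim_{f(x)}P+\varphi(x)\big)\ :\ P \text{ a finite simplicial complex},\ f\colon\mathcal{X}\to P\text{ an }\varepsilon\text{-embedding}\Big\}.$$ For $L>0$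 put $$\mathbf{d}_L(x,y)=\sup_{u\in[0,L)^d}\mathbf{d}(T^ux,T^uy),\quad \overline{\mathbf{d}}_L(x,y)=\frac1{L^d}\int_{[0,L)^d}\mathbf{d}(T^ux,T^uy)\,du,\quad \varphi_L(x)=\int_{[0,L)^d}\varphi(T^ux)\,du.$$ Define $$\mathrm{mdim}(\mathcal{X},T,\varphi)=\lim_{\varepsilon\to0}\left(\lim_{L\to\infty}\frac{\mathrm{Widim}_\varepsilon(\mathcal{X},\mathbf{d}_L,\varphi_L)}{L^d}\right);$$ the limits exist and the value does not depend on the choice of the compatible metric $\mathbf{d}$. Hausdorff dimension with potential. For a compact metric space $(\mathcal{X},\mathbf{d})$, continuous $\varphi\colon\mathcal{X}\to\mathbb{R}$, $\varepsilon>0$ and $s>\max\varphi$, $$\mathcal{H}^s_\varepsilon(\mathcal{X},\mathbf{d},\varphi)=\inf\Big\{\sum_{n=1}^\infty(\mathrm{Diam}\,E_n)^{s-\sup_{E_n}\varphi}\ :\ \mathcal{X}=E_1\cup E_2\cup\cdots,\ \mathrm{Diam}\,E_n<\varepsilon\Big\}$$ (empty sets have diameter zero and contribute $0$), and $$\dim_{\mathrm{H}}(\mathcal{X},\mathbf{d},\varphi,\varepsilon)=\inf\{s\ :\ s>\max\varphi,\ \mathcal{H}^s_\varepsilon(\mathcal{X},\mathbf{d},\varphi)<1\}.$$ The lower $L^1$-mean Hausdorff dimension with potential is $$\underline{\mathrm{mdim}}_{\mathrm{H},L^1}(\mathcal{X},T,\mathbf{d},\varphi)=\lim_{\varepsilon\to0}\left(\liminf_{L\to\infty}\frac{\dim_{\mathrm{H}}(\mathcal{X},\overline{\mathbf{d}}_L,\varphi_L,\varepsilon)}{L^d}\right).$$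 *)

(* Defs.v *)
From HB Require Import structures.
From mathcomp Require Import all_boot all_order all_algebra.
From mathcomp Require Import all_classical all_reals all_analysis.

Set Implicit Arguments.
Unset Strict Implicit.
Unset Printing Implicit Defensive.

Import Order.TTheory GRing.Theory Num.Theory.
Import numFieldNormedType.Exports.

Local Open Scope classical_set_scope.
Local Open Scope ring_scope.

Section cons_measure.
Context {R : realType} {d} {T : measurableType d} (n : nat).
Variable m1 : {sigma_finite_measure set T -> \bar R}.
Variable m : {sigma_finite_measure set (n.-tuple T) -> \bar R}.

Definition cons_pair (p : T * n.-tuple T) :
  n.+1.-tuple T := [tuple of p.1 :: p.2].

Lemma measurable_cons_pair : measurable_fun setT cons_pair.
Proof. exact: measurable_cons. Qed.

Definition cons_measure : set (n.+1.-tuple T) -> \bar R :=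
  pushforward (m1 \x m)%E cons_pair.

Let push : {measure set (n.+1.-tuple T) -> \bar R} :=
  measure_function_pushforward__canonical__measure_function_Measure
    (m1 \x m)%E measurable_cons_pair.

Let cons_measure0 : cons_measure set0 = 0%E.
Proof. exact: (measure0 push). Qed.

Let cons_measure_ge0 A : (0 <= cons_measure A)%E.
Proof. exact: (measure_ge0 push). Qed.

Let cons_measure_additive : semi_sigma_additive cons_measure.
Proof. exact: (@measure_semi_sigma_additive _ _ _ push). Qed.

HB.instance Definition _ := isMeasure.Build _ _ _ cons_measure
  cons_measure0 cons_measure_ge0 cons_measure_additive.

Let cons_measure_sigma_finite : sigma_finite setT cons_measure.
Proof.
have /sigma_finiteP[F [TF ndF mF]] := sigma_finiteT m1.
have /sigma_finiteP[G [TG ndG mG]] := sigma_finiteT m.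
pose split_tuple (t : n.+1.-tuple T) := (thead t, [tuple of behead t]).
have split_cons p : split_tuple (cons_pair p) = p.
  by case: p => x t; congr pair; apply/val_inj.
exists (fun i => split_tuple @^-1` (F i `*` G i)).
  rewrite -preimage_bigcup -[LHS](preimage_setT split_tuple); congr preimage.
  apply/esym/seteqP; split=> // -[x y] _.
  have [i _ Fx] : (\bigcup_i F i) x by rewrite -TF.
  have [j _ Gy] : (\bigcup_i G i) y by rewrite -TG.
  exists (maxn i j) => //; split => /=.
    by move: x Fx; exact/subsetPset/ndF/leq_maxl.
  by move: y Gy; exact/subsetPset/ndG/leq_maxr.
move=> i; have [mFi Fi] := mF i; have [mGi Gi] := mG i; split.
  rewrite -[X in measurable X]setTI.
  have : measurable_fun setT split_tuple.
    apply/measurable_fun_pairP; split; first exact: measurable_tnth.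
    exact: measurable_behead.
  by apply => //; exact: measurableX.
rewrite /cons_measure /pushforward.
rewrite (_ : _ @^-1` _ = F i `*` G i).
  by rewrite product_measure1E// lte_mul_pinfty// ge0_fin_numE.
by apply/funext => p; rewrite -[in RHS](split_cons p).
Qed.

HB.instance Definition _ := Measure_isSigmaFinite.Build _ _ _ cons_measure
  cons_measure_sigma_finite.

End cons_measure.

(* Lebesgue measure on R^n, as the n-fold product of [lebesgue_measure]; for
   n = 0 it is the unit mass of the single point. *)
Fixpoint lebesgue_tuple (R : realType) (n : nat) :
    {sigma_finite_measure set (n.-tuple (measurableTypeR R)) -> \bar R} :=
  match n with
  | 0 => dirac [tuple]
  | n'.+1 => cons_measure (@lebesgue_measure R) (lebesgue_tuple R n')
  end.

Lemma lebesgue_tuple_box (R : realType) (n : nat)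
    (A : 'I_n -> set (measurableTypeR R)) : (forall i, measurable (A i)) ->
  lebesgue_tuple R n [set t | forall i, A i (tnth t i)] =
  (\prod_(i < n) lebesgue_measure (A i))%E.
Proof.
elim: n A => [|n IH] A mA.
  by rewrite big_ord0 /= diracE mem_set//= => -[].
rewrite big_ord_recl /= -IH//.
rewrite /cons_measure /pushforward.
rewrite (_ : _ @^-1` _ =
    A ord0 `*` [set t | forall i, A (lift ord0 i) (tnth t i)]).
  rewrite [LHS]product_measure1E//.
  rewrite (_ : mkset _ = \bigcap_(i : 'I_n)
    ((fun t => tnth t i) @^-1` (A (lift ord0 i)))).
    apply: fin_bigcap_measurable => // i _.
    by rewrite -[X in measurable X]setTI; exact: measurable_tnth.
  by apply/seteqP; split => t /= + i => /(_ i)//; apply.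
apply/seteqP; split => -[x t] /=.
  by move=> h; split; [exact: (h ord0)|move=> i; have := h (lift ord0 i); rewrite tnthS].
move=> [Ax At] i; case: (unliftP ord0 i) => [j ->|->//].
by rewrite tnthS.
Qed.

Section metric_spaces.
Context {R : realType} {X : topologicalType}.
Implicit Types (dist : X -> X -> R) (A : set X).

(* [dist] is a metric inducing the topology of X. *)
Definition compatible_metric dist :=
  [/\ forall x y, 0 <= dist x y,
      forall x y, dist x y = 0 <-> x = y,
      forall x y, dist x y = dist y x,
      forall x y z, dist x z <= dist x y + dist y z &
      forall x A, nbhs x A <->
        exists2 e, 0 < e & [set y | dist x y < e] `<=` A].

(* [sup set0 = 0], so the empty set has diameter 0. *)
Definition diam dist A : R := sup [set dist p.1 p.2 | p in A `*` A].

Definition eps_embedding {Y : topologicalType} dist (e : R) (f : X -> Y) :=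
  continuous f /\ forall y, diam dist (f @^-1` [set y]) < e.

End metric_spaces.

(* A finite simplicial complex with vertices among 0, ..., n-1, given by the
   vertex sets of its (nonempty) simplices. *)
Record simplicial_complex (n : nat) := SimplicialComplex {
  simplices : {set {set 'I_n}} ;
  simplices_neq0 : finset.set0 \notin simplices ;
  simplices_face : forall s t : {set 'I_n},
    s \in simplices -> t \subset s -> t != finset.set0 -> t \in simplices }.

Section realization.
Context {R : realType} {n : nat}.
Implicit Types (P : simplicial_complex n) (a : 'rV[R]_n).

(* Vertices with a nonzero barycentric coordinate; the (closed) simplices
   containing a are those whose vertex set contains [vertex_support a]. *)
Definition vertex_support a : {set 'I_n} := finset (fun i => a ord0 i != 0).

(* Geometric realization in barycentric coordinates. *)
Definition realization P : set 'rV[R]_n :=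
  [set a : 'rV[R]_n | [/\ forall i, 0 <= a ord0 i, \sum_i a ord0 i = 1 &
               vertex_support a \in simplices P]].

Definition local_dim P a : nat :=
  \max_(s in simplices P | vertex_support a \subset s) #|s|.-1.

End realization.

Section widim.
Context {R : realType} {X : topologicalType}.

(* A continuous map into |P| is a continuous map into R^n with values in |P|;
   its fibres over points outside |P| are empty, hence of diameter 0.  The
   supremum over x is a maximum because [local_dim P] is upper
   semicontinuous. *)
Definition widim (e : R) (dist : X -> X -> R) (phi : X -> R) : \bar R :=
  ereal_inf [set w | exists n (P : simplicial_complex n) (f : X -> 'rV[R]_n),
    [/\ forall x, realization P (f x), eps_embedding dist e f &
        w = ereal_sup (range (fun x => ((local_dim P (f x))%:R + phi x)%:E))]].

End widim.

Section hausdorff_dimension.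
Context {R : realType} {X : topologicalType}.
Implicit Types (dist : X -> X -> R) (phi : X -> R).

(* The empty set is treated apart because [powR 0 0 = 1]. *)
Definition hausdorff_term dist phi (s : R) (E : set X) : R :=
  if E == set0 then 0 else diam dist E `^ (s - sup (phi @` E)).

Definition hausdorff_content (s e : R) dist phi : \bar R :=
  ereal_inf [set h | exists E : (set X)^nat,
    [/\ \bigcup_n E n = setT, forall n, diam dist (E n) < e &
        h = (\sum_(n <oo) (hausdorff_term dist phi s (E n))%:E)%E]].

Definition hausdorff_dim dist phi (e : R) : \bar R :=
  ereal_inf [set s%:E | s in
    [set s | sup (range phi) < s /\ (hausdorff_content s e dist phi < 1)%E]].

End hausdorff_dimension.

Section action.
Context {R : realType} {d : nat} {X : topologicalType}.
Implicit Types (T : 'rV[R]_d -> X -> X) (dist : X -> X -> R) (phi : X -> R).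

Definition continuous_action T :=
  [/\ continuous (fun p : 'rV[R]_d * X => T p.1 p.2),
      forall x, T 0 x = x &
      forall u v x, T (u + v) x = T u (T v x)].

Definition cube (L : R) : set 'rV[R]_d :=
  [set u | forall i, 0 <= u ord0 i < L].

(* The integral of f over [0, L)^d; 'rV[R]_d carries no sigma-algebra in the
   library, so it is identified with the tuples of its coordinates. *)
Definition row_of_tuple (t : d.-tuple R) : 'rV[R]_d := \row_i tnth t i.

Definition cube_integral (L : R) (f : 'rV[R]_d -> R) : R :=
  \int[lebesgue_tuple R d]_(t in row_of_tuple @^-1` cube L) f (row_of_tuple t).

Definition dist_sup T dist (L : R) (x y : X) : R :=
  sup [set dist (T u x) (T u y) | u in cube L].

Definition dist_mean T dist (L : R) (x y : X) : R :=
  L ^- d * cube_integral L (fun u => dist (T u x) (T u y)).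

Definition potential_sum T phi (L : R) (x : X) : R :=
  cube_integral L (fun u => phi (T u x)).

(* [lim] is meaningful only for a convergent function; the limits here exist:
   in L by subadditivity (Ornstein-Weiss), in e by monotonicity.  The value does
   not depend on the compatible metric [dist] on X. *)
Definition mdim T dist phi : \bar R :=
  lim (lim (widim e (dist_sup T dist L) (potential_sum T phi L) *
            (L ^- d)%:E @[L --> +oo%R])%E @[e --> 0^'+]).

Definition lower_L1_mdimH T dist phi : \bar R :=
  lim (limf_einf (fun L : R =>
         hausdorff_dim (dist_mean T dist L) (potential_sum T phi L) e *
         (L ^- d)%:E)%E (pinfty_nbhs R) @[e --> 0^'+]).

End action.

(* Main.v *)
Require Import Defs.
From HB Require Import structures.
From mathcomp Require Import all_boot all_order all_algebra.
From mathcomp Require Import all_classical all_reals all_analysis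
  measurable_realfun.
From mathcomp Require Import ring lra.

Set Implicit Arguments.
Unset Strict Implicit.
Unset Printing Implicit Defensive.

Import Order.TTheory GRing.Theory Num.Theory.
Import numFieldNormedType.Exports.

Local Open Scope classical_set_scope.
Local Open Scope ring_scope.

(* If the Hausdorff content of X for the mean metric over [0, L)^d is below 1,
   a map of X into a product of N = O(L^d) intervals, almost injective at scale
   epsilon and Lipschitz from the mean metric to the l^1 metric, is obtained by
   averaging over small cells of [0, L)^d the distances to the points of a
   finite net.  Cutting every interval at breakpoints turns it into a path and X
   into a subset of a product of paths, hence into a simplicial complex whose
   dimension at x is the number of coordinates of x lying near a breakpoint.
   For random breakpoints, a set of diameter r contains a point with k such
   coordinates with probability at most exp(O(N)) r^k; the factor exp(O(N)) is
   absorbed by r^(tau L^d) when r is small, so that a union bound over a cover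
   of small content yields breakpoints for which the dimension plus the
   potential exceeds the Hausdorff exponent by O(tau L^d) only.  The limit over
   L defining the mean dimension is an infimum because cubes are unions of
   smaller cubes and triangulated products of complexes add local dimensions. *)

(** * Products of simplices *)

(** The sets of the cover have unrelated sizes, yet one choice of breakpoints must suit all of them.
    Each set of radius r is therefore tested at its own scale [lam = 1/r] by the smooth penalty
    [1 + lam / (1 + (lam * y) ^+ 2)], y being the offset of a breakpoint. Averaged over the position
    of the breakpoint it is at most 1 + pi whatever [lam], while k hits push the product of the
    penalties above lam^k exp(-O(N)). Against the weight r^(a+m) of the set, k >= a + m hits would
    make a single term of the weighted sum exceed the bound on the whole sum. Choosing breakpoints
    one by one below the average replaces the probability space. The exponent -O(N) collects the
    offsets of all coordinates, so only their l^1 sum matters; this is why the mean metric suffices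
    where a bound on each coordinate would call for the sup metric. The net, the cell size and
    [delta] depend on the precision only and not on L, so that [delta] can be fixed while L grows.
    Mean dimension is computed with [rho], net and averages with [dist]; the two metrics meet only
    through uniform continuity on the compact space. *)

Definition supp (R : realType) (I : finType) (f : I -> R) : {pred I} :=
  [pred i | 0 < f i].

Section product_of_simplices.
Variables (R : realType) (J : finType) (n : nat).
Implicit Types (f : J -> 'I_n -> R) (v : {ffun J -> 'I_n}).

Definition prob_vectors f :=
  (forall j i, 0 <= f j i) /\ (forall j, \sum_i f j i = 1).

Definition cumul f j (k : nat) : R := \sum_(i < n | (i < k)%N) f j i.

(** For probability vectors the cumulated sums lie in [0, 1], so the default values 0 and 1 decide
    only the case of empty [J], where the single index gets the whole interval [0, 1). *)
Definition staircase_lo f v : R := \big[Num.max/0]_j cumul f j (v j).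
Definition staircase_hi f v : R := \big[Num.min/1]_j cumul f j (v j).+1.

(** The comonotone coupling of the distributions [f j]: the mass of [v] is the length of the set of
    quantiles t at which every [f j] takes the value [v j]. These are the barycentric coordinates in
    the staircase triangulation of a product of simplices. *)
Definition staircase f v : R := Num.max 0 (staircase_hi f v - staircase_lo f v).

Lemma cumul0 f j : cumul f j 0 = 0.
Proof. by rewrite /cumul big_pred0. Qed.

Lemma cumulS f j (i : 'I_n) : cumul f j i.+1 = cumul f j i + f j i.
Proof.
rewrite /cumul (bigD1 i)//= addrC; congr (_ + _).
by apply: eq_bigl => k; rewrite ltnS ltn_neqAle andbC -val_eqE.
Qed.

Lemma cumul_le f j (k l : nat) : prob_vectors f -> (k <= l)%N ->
  cumul f j k <= cumul f j l.
Proof.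
move=> [f0 _] kl; rewrite /cumul [leRHS]big_mkcond [leLHS]big_mkcond.
apply: ler_sum => i _; case: ifPn => [ik|_]; last by case: ifP.
by rewrite (leq_trans ik kl).
Qed.

Lemma cumul_ge0 f j k : prob_vectors f -> 0 <= cumul f j k.
Proof. by move=> [f0 _]; apply: sumr_ge0. Qed.

Lemma cumul_n f j : prob_vectors f -> cumul f j n = 1.
Proof.
by move=> [_ f1]; rewrite -(f1 j) /cumul; apply: eq_bigl => i; rewrite ltn_ord.
Qed.

Lemma cumul_le1 f j k : prob_vectors f -> cumul f j k <= 1.
Proof.
move=> [f0 f1]; rewrite -(f1 j) /cumul [leLHS]big_mkcond.
by apply: ler_sum => i _; case: ifP.
Qed.

(* The parameter interval on which the monotone path [t |-> (the index i with
   cumul f j i <= t < cumul f j i.+1)_j] stays at [v]. *)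
Definition staircase_itv f v : set R :=
  [set` `[staircase_lo f v, staircase_hi f v[].

Lemma staircase_itvP f v t : staircase_itv f v t <->
  0 <= t < 1 /\ forall j, cumul f j (v j) <= t < cumul f j (v j).+1.
Proof.
rewrite /staircase_itv /= in_itv /= /staircase_lo /staircase_hi; split.
  move=> /andP[lo hi]; split.
    apply/andP; split.
      by apply: le_trans lo; rewrite bigmax_ge_id.
    by apply: lt_le_trans hi _; rewrite bigmin_le_id.
  move=> j; apply/andP; split.
    by apply: le_trans lo; exact: le_bigmax.
  by apply: lt_le_trans hi _; exact: bigmin_le.
move=> [/andP[t0 t1] h]; apply/andP; split.
  by apply/bigmax_leP; split => // j _; case/andP: (h j).
by apply/bigmin_gtP; split => // j _; case/andP: (h j).
Qed.

Lemma staircase_ge0 f v : 0 <= staircase f v.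
Proof. by rewrite /staircase le_max lexx. Qed.

Lemma staircase_measure f v :
  (staircase f v)%:E = @lebesgue_measure R (staircase_itv f v).
Proof.
rewrite /staircase_itv lebesgue_measure_itv /= lte_fin /staircase.
case: ltP => h; first by rewrite -EFinB max_r// subr_ge0 ltW.
by rewrite max_l// subr_le0.
Qed.

Lemma staircase_gt0P f v : 0 < staircase f v <-> exists t, staircase_itv f v t.
Proof.
rewrite /staircase lt_max ltxx /= subr_gt0; split=> [lh|[t]].
  by exists (staircase_lo f v); rewrite /staircase_itv /= in_itv /= lexx.
by rewrite /staircase_itv /= in_itv /= => /andP[]; exact: le_lt_trans.
Qed.

Lemma staircase_idx f t : prob_vectors f -> 0 <= t < 1 ->
  exists v, staircase_itv f v t.
Proof.
move=> pf /andP[t0 t1].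
have H j : exists i : 'I_n, cumul f j i <= t < cumul f j i.+1.
  have ex : exists k, t < cumul f j k by exists n; rewrite cumul_n.
  case: (ex_minnP ex) => -[|k] kt kmin.
    by move: kt; rewrite cumul0 ltNge t0.
  have kn : (k < n)%N by apply: kmin; rewrite cumul_n.
  exists (Ordinal kn) => /=; rewrite kt andbT leNgt.
  by apply/negP => /kmin; rewrite ltnn.
have /choice[g gP] := H.
exists [ffun j => g j]; apply/staircase_itvP; rewrite t0 t1; split => // j.
by rewrite ffunE.
Qed.

Lemma staircase_itv_mono f v w t u : prob_vectors f -> t <= u ->
  staircase_itv f v t -> staircase_itv f w u -> forall j, (v j <= w j)%N.
Proof.
move=> pf tu /staircase_itvP[_ hv] /staircase_itvP[_ hw] j.
rewrite leqNgt; apply/negP => wv.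
have /andP[h1 _] := hv j; have /andP[_ h2] := hw j.
have := cumul_le j pf wv; lra.
Qed.

Lemma staircase_itv_inj f v w t : prob_vectors f ->
  staircase_itv f v t -> staircase_itv f w t -> v = w.
Proof.
move=> pf vt wt; apply/ffunP => j; apply/val_inj/eqP; rewrite eqn_leq.
by rewrite (staircase_itv_mono pf (lexx t) vt wt)
  (staircase_itv_mono pf (lexx t) wt vt).
Qed.

(** The parameter intervals are pairwise disjoint, so masses add up to the length of a union; total
    mass and marginals are both read off from that union. *)
Lemma staircase_sum f (P : pred {ffun J -> 'I_n}) : prob_vectors f ->
  (\sum_(v | P v) staircase f v)%:E =
  @lebesgue_measure R (\bigcup_(v in [set v | P v]) staircase_itv f v).
Proof.
move=> pf; rewrite measure_fin_bigcup//=.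
- rewrite (fsbigE (enum P) _ (enum_uniq _)) /=; last 2 first.
  + by move=> v /=; rewrite mem_enum.
  + by move=> v Pv /negP[]; rewrite mem_enum.
  rewrite -sumEFin big_enum_cond /=; apply: eq_big => [v|v _].
    by rewrite andb_idr// => Pv; rewrite inE.
  by rewrite staircase_measure.
- move=> v w _ _ [t [vt wt]]; exact: staircase_itv_inj vt wt.
- by move=> v _; exact: measurable_itv.
Qed.

Lemma staircase_sum1 f : prob_vectors f -> \sum_v staircase f v = 1.
Proof.
move=> pf; apply: EFin_inj; rewrite staircase_sum//.
rewrite (_ : \bigcup_(_ in _) _ = [set` `[0%R, 1%R[]).
  by rewrite lebesgue_measure_itv /= lte_fin ltr01 sube0.
apply/seteqP; split => [t [v _ /staircase_itvP[]]|t] /=;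
  first by rewrite in_itv.
by rewrite in_itv /= => /(staircase_idx pf)[v vt]; exists v.
Qed.

Lemma staircase_marginal f j i : prob_vectors f ->
  \sum_(v : {ffun J -> 'I_n} | v j == i) staircase f v = f j i.
Proof.
move=> pf; apply: EFin_inj; rewrite staircase_sum//.
rewrite (_ : \bigcup_(_ in _) _ = [set` `[cumul f j i, cumul f j i.+1[]).
  rewrite lebesgue_measure_itv /= lte_fin cumulS ltrDl.
  have := pf.1 j i; rewrite le_eqVlt => /predU1P[<-|->]; first by rewrite ltxx.
  by rewrite -EFinB addrAC subrr add0r.
apply/seteqP; split => [t [v /eqP <- /staircase_itvP[_ /(_ j)]]|t] /=.
  by rewrite in_itv.
rewrite in_itv /= => /andP[it ti].
have t01 : 0 <= t < 1.
  by rewrite (le_trans (cumul_ge0 _ _ pf) it) (lt_le_trans ti (cumul_le1 _ _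
    pf)).
have [v vt] := staircase_idx pf t01; exists v => //=.
have /staircase_itvP[_ /(_ j)/andP[h1 h2]] := vt.
apply/eqP/val_inj/eqP; rewrite eqn_leq; apply/andP; split; rewrite leqNgt.
  by apply/negP => h; have := cumul_le j pf h; lra.
by apply/negP => h; have := cumul_le j pf h; lra.
Qed.

Lemma staircase_support f v j : prob_vectors f ->
  0 < staircase f v -> 0 < f j (v j).
Proof.
move=> pf /staircase_gt0P[t /staircase_itvP[_ /(_ j)]].
by rewrite cumulS => h; lra.
Qed.

Lemma support_staircase f j i : prob_vectors f -> 0 < f j i ->
  exists2 v, 0 < staircase f v & v j = i.
Proof.
move=> pf fi; apply/not_exists2P => h.
have : \sum_(v : {ffun J -> 'I_n} | v j == i) staircase f v = 0.
  apply: big1 => v /eqP vj; have [|//] := h v.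
  by move/negP; rewrite -leNgt => v0; apply/le_anti; rewrite v0 staircase_ge0.
by rewrite staircase_marginal// => f0; rewrite f0 ltxx in fi.
Qed.

(* The support is a chain for the coordinatewise order, and the rank
   [\sum_j #{k in supp (f j) | k < v j}] is injective on it. *)
Lemma card_staircase_support f : prob_vectors f ->
  (#|supp (staircase f)|.-1 <= \sum_j #|supp (f j)|.-1)%N.
Proof.
move=> pf.
pose rk v := (\sum_j #|[pred i : 'I_n | (0 < f j i)%R && (i < v j)%N]|)%N.
set D := (\sum_j _)%N.
have rkD v : 0 < staircase f v -> (rk v < D.+1)%N.
  move=> v0; rewrite ltnS; apply: leq_sum => j _.
  rewrite -ltnS (@ltn_predK 0); last first.
    by apply/card_gt0P; exists (v j); rewrite inE (staircase_support _ pf).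
  apply: proper_card; apply/properP; split.
    by apply/fintype.subsetP => i; rewrite !inE => /andP[].
  by exists (v j); rewrite !inE ?(staircase_support _ pf)// ltnn andbF.
have rk_mono v w : 0 < staircase f v -> 0 < staircase f w ->
    (forall j, (v j <= w j)%N) -> rk v = rk w -> v = w.
  move=> v0 w0 vw rkvw.
  have sub j : {subset [pred i : 'I_n | (0 < f j i)%R && (i < v j)%N] <=
                       [pred i : 'I_n | (0 < f j i)%R && (i < w j)%N]}.
    by move=> i; rewrite !inE => /andP[-> /leq_trans]; apply.
  apply/ffunP => j; apply/val_inj/eqP; rewrite eqn_leq vw /= leqNgt.
  apply/negP => vwj; have : (rk v < rk w)%N; last by rewrite rkvw ltnn.
  rewrite /rk (bigD1 j)//= [X in (_ < X)%N](bigD1 j)//= -addSn leq_add//.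
    apply: proper_card; apply/properP; split; first exact/fintype.subsetP/sub.
    by exists (v j); rewrite !inE ?(staircase_support _ pf)//= ltnn.
  by apply: leq_sum => k _; apply: subset_leq_card; apply/fintype.subsetP/sub.
pose g v : 'I_D.+1 := inord (rk v).
have ginj : {in supp (staircase f) &, injective g}.
  move=> v w; rewrite !inE => v0 w0 /(congr1 val) /=.
  rewrite !inordK ?rkD// => rkvw.
  have /staircase_gt0P[t vt] := v0; have /staircase_gt0P[u wu] := w0.
  have [tu|/ltW ut] := leP t u.
    by apply: rk_mono => //; exact: staircase_itv_mono tu vt wu.
  by apply/esym; apply: rk_mono => //; exact: staircase_itv_mono ut wu vt.
have : (#|supp (staircase f)| <= D.+1)%N.
  by rewrite -(card_in_image ginj) -[X in (_ <= X)%N]card_ord max_card.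
by case: #|_|.
Qed.

End product_of_simplices.

Section staircase_continuous.
Variables (R : realType) (X : topologicalType) (J : finType) (n : nat).

Lemma continuous_bigmax (I : Type) (r : seq I) (F : I -> X -> R) (c : R) :
  (forall i, continuous (F i)) ->
  continuous (fun x => \big[Num.max/c]_(i <- r) F i x).
Proof.
move=> Fc; elim: r => [|i r IH] x.
  by under eq_fun do rewrite big_nil; exact: cvg_cst.
under eq_fun do rewrite big_cons.
exact: (continuous_max (Fc i x) (IH x)).
Qed.

Lemma continuous_bigmin (I : Type) (r : seq I) (F : I -> X -> R) (c : R) :
  (forall i, continuous (F i)) ->
  continuous (fun x => \big[Num.min/c]_(i <- r) F i x).
Proof.
move=> Fc; elim: r => [|i r IH] x.
  by under eq_fun do rewrite big_nil; exact: cvg_cst.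
under eq_fun do rewrite big_cons.
exact: (continuous_min (Fc i x) (IH x)).
Qed.

Lemma continuous_staircase (f : X -> J -> 'I_n -> R) (v : {ffun J -> 'I_n}) :
  (forall j i, continuous (fun x => f x j i)) ->
  continuous (fun x => staircase (f x) v).
Proof.
move=> fc.
have cc j k : continuous (fun x => cumul (f x) j k).
  by move=> x; apply: cvg_big => [|i _]; [exact: add_continuous|exact: fc].
move=> x; apply: (@continuous_max R X (fun=> 0)); first exact: cvg_cst.
by apply: cvgB; [apply: continuous_bigmin|apply: continuous_bigmax] => j.
Qed.

End staircase_continuous.

(** * Width dimension from families of probability vectors *)

Section widim_upper_bound.
Variables (R : realType) (X : topologicalType).

Lemma continuous_row (Y : topologicalType) n (g : Y -> 'rV[R]_n) :
  (forall i, continuous (fun x => g x ord0 i)) -> continuous g.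
Proof.
move=> gc x A [P gxP PA].
have H : \forall y \near x, forall i, P ord0 i (g y ord0 i).
  by apply: filter_forall => i; apply: (gc i x); exact: gxP.
by apply: filterS H => y Py; apply: PA => i j; rewrite ord1.
Qed.

(** The coupling maps X into a complex whose vertices are the index functions; its marginals recover
    [f], so the fibres are those of [f]. The dimension is bounded over pairs x, y because a simplex
    through the image of x may come from the support of another point y, whose coordinates are
    positive wherever those of x are. *)
Lemma widim_le_staircase (J : finType) (n : nat) (f : X -> J -> 'I_n -> R)
    (e : R) (dist : X -> X -> R) (phi : X -> R) (w : R) :
  0 < e -> (forall x, prob_vectors (f x)) ->
  (forall j i, continuous (fun x => f x j i)) ->
  (forall c : J -> 'I_n -> R,
     diam dist [set x | forall j i, f x j i = c j i] < e) ->
  (forall x y, (forall j i, 0 < f x j i -> 0 < f y j i) ->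
     (\sum_j #|supp (f y j)|.-1)%:R + phi x <= w) ->
  (widim e dist phi <= w%:E)%E.
Proof.
move=> e0 pf fc fib dimw.
pose V : finType := {ffun J -> 'I_n}.
pose g x : 'rV[R]_#|V| := \row_k staircase (f x) (enum_val k).
have gE x k : g x ord0 k = staircase (f x) (enum_val k) by rewrite mxE.
have vsg x k : (k \in vertex_support (g x)) = (0 < staircase (f x) (enum_val
  k)).
  by rewrite inE gE lt_neqAle eq_sym staircase_ge0 andbT.
have card_vsg x : #|vertex_support (g x)| = #|supp (staircase (f x))|.
  rewrite -(fintype.card_image (@enum_val_inj V predT) (vertex_support (g x)));
    apply: eq_card => v.
  apply/fintype.imageP/idP => [[k + ->]|]; first by rewrite vsg.
  by move=> v0; exists (enum_rank v); rewrite ?enum_rankK// vsg enum_rankK.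
have vs_neq0 x : vertex_support (g x) != finset.set0.
  rewrite -cards_eq0 card_vsg -lt0n; apply/card_gt0P.
  have [v vt] := @staircase_idx _ _ _ _ 0 (pf x) (@introT _ _ andP (conj (lexx
    0) ltr01)).
  by exists v; apply/staircase_gt0P; exists 0.
(* Only faces of supports that occur are kept, so that dimension is measured along the image and not
   in the whole product. *)
pose S := finset (fun s : {set 'I_#|V|} => (s != finset.set0) &&
  `[< exists y, s \subset vertex_support (g y) >]).
have S0 : finset.set0 \notin S by rewrite inE eqxx.
have Sface (s t : {set 'I_#|V|}) : s \in S -> t \subset s ->
  t != finset.set0 -> t \in S.
  rewrite !inE => /andP[_ /asboolP[y sy]] ts ->/=; apply/asboolP; exists y.
  exact: fintype.subset_trans ts sy.
pose P := SimplicialComplex S0 Sface.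
have gP x : realization P (g x).
  split=> [i||]; first by rewrite gE staircase_ge0.
    rewrite -(staircase_sum1 (pf x)) [RHS](reindex _ (onW_bij _ (enum_val_bij
      V))).
    by apply: eq_bigr => i _; rewrite gE.
  by rewrite inE vs_neq0; apply/asboolP; exists x.
apply: (@le_trans _ _ (ereal_sup (range (fun x => ((local_dim P (g x))%:R + phi
  x)%:E)))).
  apply: ereal_inf_lbound; exists #|V|, P, g; split => //; split.
    apply: continuous_row => k; under eq_fun do rewrite gE.
    exact: continuous_staircase.
  move=> c; have [[x0 <-]|nc] := pselect (exists x, g x = c); last first.
    rewrite (_ : _ @^-1` _ = set0); last first.
      by apply/seteqP; split => // x gx; apply: nc; exists x.
    by rewrite /diam setX0 image_set0 sup0.
  rewrite (_ : _ @^-1` _ = [set x | forall j i, f x j i = f x0 j i]);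
    first exact: fib.
  apply/seteqP; split=> x /= => [gx j i|fx].
    rewrite -(staircase_marginal j i (pf x)) -(staircase_marginal j i (pf x0)).
    apply: eq_bigr => v _; have : g x ord0 (enum_rank v) = g x0 ord0 (enum_rank
      v) by rewrite gx.
    by rewrite !gE enum_rankK.
  by apply/rowP => k; rewrite !mxE; congr (staircase _ _); apply/funext => j;
    apply/funext.
apply: ge_ereal_sup => _ [x _ <-]; rewrite lee_fin.
(* A simplex of largest dimension through [g x] is a face of the support of some [g y]. *)
have [y [xy ly]] : exists y,
  vertex_support (g x) \subset vertex_support (g y) /\
    (local_dim P (g x) <= #|supp (staircase (f y))|.-1)%N.
  pose A := [pred s in S | vertex_support (g x) \subset s].
  have A0 : (0 < #|A|)%N.
    apply/card_gt0P; exists (vertex_support (g x));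
      rewrite inE/= fintype.subxx andbT.
    by rewrite inE vs_neq0; apply/asboolP; exists x.
  rewrite /local_dim; have [s /andP[]] := eq_bigmax_cond (fun s : {set 'I_#|V|}
    => #|s|.-1) A0.
  rewrite inE => /andP[s0 /asboolP[y sy]] xs ->; exists y.
  split; first exact: fintype.subset_trans xs sy.
  by rewrite -card_vsg -!subn1 leq_sub2r// subset_leq_card.
apply: le_trans (dimw x y _).
  rewrite lerD2r ler_nat (leq_trans ly)//; exact: card_staircase_support.
move=> j i /(support_staircase (pf x))[v v0 vj].
have := fintype.subsetP xy (enum_rank v); rewrite !vsg !enum_rankK => /(_ v0).
by rewrite -vj; apply: staircase_support.
Qed.

End widim_upper_bound.

(** * Lebesgue integrals over boxes *)

Section row_measurable.
Variables (R : realType) (d : nat).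
Notation mR := (measurableTypeR R).
Implicit Types h : 'rV[R]_d -> R.

Definition row_box (v : 'rV[R]_d) (M : R) : set (d.-tuple mR) :=
  @row_of_tuple R d @^-1` [set u | forall i,
    v ord0 i <= u ord0 i < v ord0 i + M].

Lemma row_boxE v M : row_box v M =
  [set t | forall i, [set` `[v ord0 i, v ord0 i + M[] (tnth t i)].
Proof.
by apply/seteqP; split => t /= H i; have := H i; rewrite in_itv /= mxE.
Qed.

Lemma measurable_tuple_box (A : 'I_d ->
  set mR) : (forall i, measurable (A i)) ->
  measurable [set t : d.-tuple mR | forall i, A i (tnth t i)].
Proof.
move=> mA; rewrite (_ : mkset _ = \bigcap_(i : 'I_d) ((fun t => tnth t i) @^-1`
  A i)).
  apply: fin_bigcap_measurable => // i _.
  by rewrite -[X in measurable X]setTI; exact: measurable_tnth.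
by apply/seteqP; split => t /= + i => /(_ i)//; apply.
Qed.

Lemma measurable_row_box v M : measurable (row_box v M).
Proof.
rewrite row_boxE.
apply: (measurable_tuple_box (A := fun i => [set` `[v ord0 i,
  v ord0 i + M[])) => i.
exact: measurable_itv.
Qed.

Lemma row_box_measure v M : 0 < M ->
  lebesgue_tuple R d (row_box v M) = (M ^+ d)%:E.
Proof.
move=> M0; rewrite row_boxE (lebesgue_tuple_box (A := fun i => [set` `[v ord0
  i, v ord0 i + M[])); last first.
  by move=> i; exact: measurable_itv.
under eq_bigr => i _.
  rewrite lebesgue_measure_itv /= lte_fin ltrDl M0 -EFinB.
  rewrite (_ : _ - _ = M); last by rewrite addrAC subrr add0r.
  over.
by rewrite prodEFin prodr_const card_ord.
Qed.

Lemma ball_rat (x e : R) : 0 < e -> exists q : rat, ball (ratr q : R) e x.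
Proof.
move=> e0; have /rat_in_itvoo[q] : x - e < x + e by lra.
rewrite in_itv /= => /andP[q1 q2]; exists q; rewrite -ball_normE /=.
by rewrite ltr_norml; apply/andP; split; lra.
Qed.

(* Open sets of rows are countable unions of boxes with rational centres. *)
Lemma measurable_row_open (U : set 'rV[R]_d) : open U ->
  measurable (@row_of_tuple R d @^-1` U : set (d.-tuple mR)).
Proof.
move=> oU; pose pre : set (d.-tuple mR) := @row_of_tuple R d @^-1` U.
pose W (p : d.-tuple rat * nat) : set (d.-tuple mR) :=
  [set t | forall i, ball (ratr (tnth p.1 i) : R) p.2.+1%:R^-1 (tnth t i)].
have mW p : measurable (W p).
  apply: (measurable_tuple_box (A := fun i => ball (ratr (tnth p.1 i) : R)
    p.2.+1%:R^-1)) => i.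
  exact: measurable_ball.
pose F (n : nat) := if (unpickle n : option (d.-tuple rat * nat)) is Some p then
  (if `[< W p `<=` pre >] then W p else set0) else set0.
rewrite -/pre (_ : pre = \bigcup_n F n); last first.
  apply/seteqP; split => [t Ut|t [n _]]; last first.
    by rewrite /F; case: unpickle => // p; case: asboolP => // Wp; exact: Wp.
  have /nbhs_ballP[e /= e0 eU] : nbhs (row_of_tuple t) U by exact:
    open_nbhs_nbhs.
  have [m me] : exists m : nat, m.+1%:R^-1 < e / 2.
    exists (Num.truncn (e / 2)^-1).
    rewrite -[ltRHS]invrK ltf_pV2 ?posrE ?invr_gt0 ?divr_gt0//.
    by rewrite truncnS_gt// .
  have m0 : 0 < m.+1%:R^-1 :> R by rewrite invr_gt0.
  have /choice[q qP] (i : 'I_d) : exists q : rat,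
      ball (ratr q : R) m.+1%:R^-1 (tnth t i).
    exact: ball_rat.
  exists (pickle ([tuple q i | i < d], m)) => //.
  rewrite /F pickleK; case: asboolP => [_ i|[]].
    by rewrite tnth_mktuple; exact: qP.
  move=> s Ws; apply: eU; split => // a i; rewrite !mxE.
  have := Ws i; rewrite /= tnth_mktuple => Wsi.
  apply: (le_ball _ (ball_triangle (ball_sym (qP i)) Wsi)).
  by rewrite (splitr e) lerD// ltW.
apply: bigcup_measurable => n _; rewrite /F.
by case: unpickle => // p; case: asboolP.
Qed.

Lemma measurable_fun_row h : continuous h ->
  measurable_fun setT (fun t : d.-tuple mR => h (row_of_tuple t)).
Proof.
move=> /continuousP ch; apply: (measurability _ (RGenOpens.measurableE R)).
move=> _ [_ [a [b ->] <-]]; rewrite setTI.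
apply: (@measurable_row_open (h @^-1` [set` `]a, b[])).
by apply: ch; exact: interval_open.
Qed.

End row_measurable.

Section box_integral.
Variables (R : realType) (d : nat).
Notation mu := (lebesgue_tuple R d).
Implicit Types (h g : 'rV[R]_d -> R) (v : 'rV[R]_d) (M : R).

Definition box_integral v M h : R := \int[mu]_(t in row_box v M) h
  (row_of_tuple t).

Lemma cube_integralE M h : cube_integral M h = box_integral 0 M h.
Proof.
rewrite /cube_integral /box_integral; congr Rintegral.
by apply/seteqP; split => t /= H i; have := H i; rewrite !mxE add0r.
Qed.

Definition closed_box v M : set 'rV[R]_d :=
  [set u | forall i, v ord0 i <= u ord0 i <= v ord0 i + M].

Lemma compact_closed_box v M : compact (closed_box v M).
Proof.
rewrite (_ : closed_box v M =
  [set u | forall i, [set` `[v ord0 i, v ord0 i + M]] (u ord0 i)]).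
  by apply: (rV_compact (A := fun i => [set` `[v ord0 i,
    v ord0 i + M]])) => i; exact: segment_compact.
by apply/seteqP; split => u /= H i; have := H i; rewrite in_itv.
Qed.

Lemma row_box_closed v M t : row_box v M t -> closed_box v M (row_of_tuple t).
Proof. by move=> H i; have /andP[-> /ltW ->] := H i. Qed.

Lemma integrable_box v M h : 0 < M -> continuous h ->
  mu.-integrable (row_box v M) (EFin \o (fun t => h (row_of_tuple t))).
Proof.
move=> M0 ch; apply: measurable_bounded_integrable.
- exact: measurable_row_box.
- by rewrite /= row_box_measure// ltry.
- by apply: measurable_funTS; exact: measurable_fun_row.
have : bounded_set (h @` closed_box v M).
  apply: compact_bounded; apply: continuous_compact (@compact_closed_box _ _).
  exact: continuous_subspaceT.
move=> [B [Breal HB]]; exists B; split => // x Bx t tb.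
by apply: HB Bx _ _; exists (row_of_tuple t) => //; exact: row_box_closed.
Qed.

Lemma box_integral_le v M h g : 0 < M -> continuous h -> continuous g ->
  (forall u, closed_box v M u -> h u <= g u) ->
  box_integral v M h <= box_integral v M g.
Proof.
move=> M0 ch cg hg; apply: le_Rintegral => [|||t tb].
- exact: measurable_row_box.
- exact: integrable_box.
- exact: integrable_box.
- exact/hg/row_box_closed.
Qed.

Lemma eq_box_integral v M h g :
  (forall u, h u = g u) -> box_integral v M h = box_integral v M g.
Proof. by move=> /funext ->. Qed.

Lemma box_integral_cst v M c : 0 < M -> box_integral v M (fun=> c) = c * M ^+ d.
Proof.
move=> M0; rewrite /box_integral (Rintegral_cst _ (@measurable_row_box _ _ _
  _)).
by congr (_ * _); exact: (congr1 fine (row_box_measure v M0)).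
Qed.

Lemma box_integralD v M h g : 0 < M -> continuous h -> continuous g ->
  box_integral v M (fun u => h u + g u) = box_integral v M h + box_integral v M
    g.
Proof.
move=> M0 ch cg; rewrite /box_integral RintegralD//.
- exact: measurable_row_box.
- exact: integrable_box.
- exact: integrable_box.
Qed.

Lemma box_integralB v M h g : 0 < M -> continuous h -> continuous g ->
  box_integral v M (fun u => h u - g u) = box_integral v M h - box_integral v M
    g.
Proof.
move=> M0 ch cg; rewrite /box_integral RintegralB//.
- exact: measurable_row_box.
- exact: integrable_box.
- exact: integrable_box.
Qed.

Lemma le_norm_box_integral v M h : 0 < M -> continuous h ->
  `|box_integral v M h| <= box_integral v M (fun u => `|h u|).
Proof.
move=> M0 ch; apply: le_normr_Rintegral; first exact: measurable_row_box.
exact: integrable_box.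
Qed.

Lemma box_integral_near v M h g c : 0 < M -> continuous h -> continuous g ->
  (forall u, closed_box v M u -> `|h u - g u| <= c) ->
  `|box_integral v M h - box_integral v M g| <= c * M ^+ d.
Proof.
move=> M0 ch cg hg.
have cB : continuous (fun u => h u - g u) by move=> u;
  exact: (cvgB (ch u) (cg u)).
rewrite -box_integralB// -(box_integral_cst v c M0).
apply: le_trans (le_norm_box_integral _ _ _) _ => //.
apply: box_integral_le => // [u|u]; last exact: cst_continuous.
exact: (cvg_norm (cB u)).
Qed.

Definition cell_shift k (c : {ffun 'I_d -> 'I_k}) M : 'rV[R]_d :=
  \row_i ((c i)%:R * M).

Lemma row_box_split v M k : 0 < M ->
  row_box v (k%:R * M) =
  \big[setU/set0]_(c <- enum {: {ffun 'I_d ->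
    'I_k}}) row_box (v + cell_shift c M) M.
Proof.
move=> M0; rewrite -bigcup_seq; apply/seteqP; split => [t tb|t [c _ cb] i].
  have H (i : 'I_d) : exists j : 'I_k,
      v ord0 i + j%:R * M <= row_of_tuple t ord0 i < v ord0 i + j%:R * M + M.
    have /andP[h1 h2] := tb i.
    move: (row_of_tuple t ord0 i) h1 h2 => x h1 h2.
    have y0 : 0 <= (x - v ord0 i) / M by rewrite divr_ge0 ?(ltW M0)// subr_ge0.
    have := truncn_itv y0; rewrite ler_pdivlMr// ltr_pdivrMr//.
    move: (Num.truncn _) => k0; rewrite -natr1 mulrDl mul1r => /andP[t1 t2].
    have k0k : (k0 < k)%N by rewrite -(ltr_nat R) -(ltr_pM2r M0); lra.
    by exists (Ordinal k0k) => /=; apply/andP; split; lra.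
  have /choice[j jP] := H.
  exists (finfun j) => /=; first by rewrite mem_enum.
  move=> i; have := jP i; rewrite !mxE ffunE; exact.
have := cb i; rewrite !mxE; move: (tnth t i : R) => x /andP[h1 h2].
have c0 : 0 <= (c i)%:R * M by rewrite mulr_ge0// ltW.
have ck : ((c i).+1%:R) * M <= k%:R * M by rewrite ler_pM2r// ler_nat.
move: ck; rewrite -natr1 mulrDl mul1r => ck.
by apply/andP; split; lra.
Qed.

Lemma row_box_split_trivIset v M k (D : set {ffun 'I_d -> 'I_k}) : 0 < M ->
  trivIset D (fun c => row_box (v + cell_shift c M) M).
Proof.
move=> M0 c c' _ _ [t [cb cb']]; apply/ffunP => i; apply/val_inj/eqP.
have := cb i; have := cb' i; rewrite !mxE;
  move: (tnth t i : R) => x /andP[h1 h2] /andP[h3 h4].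
have lt_of (a b : nat) : v ord0 i + a%:R * M <= x ->
  x < v ord0 i + b%:R * M + M -> (a <= b)%N.
  move=> h5 h6; rewrite -ltnS -(ltr_nat R) -(ltr_pM2r M0) -[X in _ < X *
    _]natr1 mulrDl mul1r; lra.
by rewrite eqn_leq !lt_of.
Qed.

Lemma box_integral_split v M k h : 0 < M -> (0 < k)%N -> continuous h ->
  box_integral v (k%:R * M) h =
  \sum_(c : {ffun 'I_d -> 'I_k}) box_integral (v + cell_shift c M) M h.
Proof.
move=> M0 k0 ch; have kM0 : 0 < k%:R * M by rewrite mulr_gt0 ?ltr0n.
apply: EFin_inj; rewrite -sumEFin /box_integral /Rintegral.
rewrite fineK; last first.
  apply: integrable_fin_num; first exact: measurable_row_box.
  exact: (integrable_box _ kM0).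
under [RHS]eq_bigr => c _.
  rewrite fineK; last first.
    apply: integrable_fin_num; first exact: measurable_row_box.
    exact: (integrable_box _ M0).
  over.
rewrite row_box_split// integral_bigsetU_EFin ?enum_uniq//.
- by rewrite big_enum.
- by move=> c; exact: measurable_row_box.
- exact: row_box_split_trivIset.
- rewrite -row_box_split//; apply/measurable_EFinP; apply: measurable_funTS.
  exact: measurable_fun_row.
Qed.

End box_integral.

Section parameter_integrals.
Variables (R : realType) (d : nat).
Implicit Types (v : 'rV[R]_d) (M : R).

(** [Y] is an arbitrary topological space, so no sequential convergence theorem is used: compactness
    of the closed box makes the continuity of [G] at y uniform in u. *)
Lemma continuous_box_integral (Y : topologicalType) (G : 'rV[R]_d -> Y ->
  R) v M :
  0 < M -> continuous (fun p : 'rV[R]_d * Y => G p.1 p.2) ->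
  continuous (fun y => box_integral v M (G ^~ y)).
Proof.
move=> M0 cG y; apply/cvgrPdist_le => e e0.
have cGy z : continuous (G ^~ z).
  by move=> u A GA; have [[A1 A2] [/= ? /nbhs_singleton A2z] sub] := cG (u,
    z) A GA;
     apply: filterS (_ : nbhs u A1) => // u' A1u'; exact: (sub (u', z)).
have e1 : 0 < e / M ^+ d by rewrite divr_gt0// exprn_gt0.
have /compact_near_coveringP cK := @compact_closed_box R d v M.
have := cK Y (nbhs y) (fun y' u => `|G u y - G u y'| <= e / M ^+ d) _.
move=> H; have {}H := H (nbhs_filter y) _.
apply: filterS (H _) => [y' sub|u _].
  rewrite -[leRHS](divfK (lt0r_neq0 (exprn_gt0 d M0))).
  by apply: box_integral_near.
have /cvgrPdist_lt /(_ _ (divr_gt0 e1 (ltr0Sn R 1))) := cG (u, y).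
move=> [[A1 A2] [/= uA1 yA2] sub].
exists (A1, A2) => // -[u' y'] [/= A1u' A2y'].
have h1 := sub (u', y') (conj A1u' A2y').
have h2 := sub (u', y) (conj A1u' (nbhs_singleton yA2)).
rewrite /= distrC in h2; rewrite /= in h1.
have -> : G u' y - G u' y' = (G u' y - G u y) + (G u y - G u' y') by ring.
apply: le_trans (ler_normD _ _) _; lra.
Qed.

Lemma uniform_modulus (h : 'rV[R]_d -> R) v M (e : R) : 0 < e -> continuous h ->
  exists2 r : R, 0 < r & forall u w : 'rV[R]_d, closed_box v M u ->
    (forall i : 'I_d, `|w ord0 i| < r) ->
    `|h (u + w) - h u| <= e.
Proof.
move=> e0 ch.
have /compact_near_coveringP cK := @compact_closed_box R d v M.
have H := cK 'rV[R]_d (nbhs (0 : 'rV[R]_d)) (fun w u => `|h (u + w) - h u| <=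
  e) (nbhs_filter _).
have /nbhs_ballP[r /= r0 rH] : \forall w \near (0 : 'rV[R]_d),
  closed_box v M `<=` (fun u => `|h (u + w) - h u| <= e).
  apply: H => u _.
  have cD : (fun p : 'rV[R]_d * 'rV[R]_d => h (p.1 + p.2)) @ (u,
    0 : 'rV[R]_d) --> h u.
    rewrite -[in X in _ --> X](addr0 u).
    exact: (@continuous_comp _ _ _ _ h (u, 0) (@add_continuous _ (u,
      0)) (ch (u + 0))).
  have e2 : 0 < e / 2 by rewrite divr_gt0.
  have /cvgrPdist_lt /(_ _ e2) := cD; move=> [[A1 A2] [/= uA1 yA2] sub].
  have /cvgrPdist_lt /(_ _ e2) B1 := ch u.
  exists (A1 `&` [set t | `|h u - h t| < e / 2], A2) => /=;
    first by split => //; exact: filterI.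
  move=> -[u' w] [/= [A1u' Bu'] A2w].
  have /= h1 := sub (u', w) (conj A1u' A2w).
  have -> : h (u' + w) - h u' = (h (u' + w) - h u) + (h u - h u') by ring.
  rewrite distrC in h1; apply: le_trans (ler_normD _ _) _; lra.
exists r => // u w uK wr; apply: rH => //.
by split => // i j; rewrite ord1 -ball_normE /= mxE sub0r normrN.
Qed.

(** Translation invariance by Riemann sums: on cells finer than the modulus of continuity, both
    integrals are close to the value of [h] at the corner of the cell times the volume of the
    cell. *)
Lemma box_integral_translate v M (h : 'rV[R]_d -> R) : 0 < M -> continuous h ->
  box_integral v M h = box_integral 0 M (fun u => h (v + u)).
Proof.
move=> M0 ch; have chv : continuous (fun u => h (v + u)).
  move=> u; apply: (@continuous_comp _ _ _ (fun u => v + u) h); last exact: ch.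
  exact: (cvgD (cvg_cst v) (@cvg_id _ (nbhs u))).
apply/eqP; rewrite -subr_eq0 -normr_le0; apply/ler_addgt0Pl => e e0;
  rewrite addr0.
have Md : 0 < M ^+ d by rewrite exprn_gt0.
have [|r r0 rH] := @uniform_modulus h v M (e / M ^+ d / 2) _ ch.
  by rewrite !divr_gt0.
pose k := (Num.truncn (M / r)).+1.
have k0 : 0 < k%:R :> R by rewrite ltr0n.
pose m := M / k%:R.
have m0 : 0 < m by rewrite divr_gt0.
have mr : m < r.
  by rewrite /m ltr_pdivrMr// mulrC -ltr_pdivrMr// truncnS_gt.
have -> : M = k%:R * m by rewrite mulrC divfK// gt_eqF.
rewrite !box_integral_split//.
have cellP (c : {ffun 'I_d -> 'I_k}) : closed_box v M (v + cell_shift c m).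
  move=> i; rewrite !mxE lerDl mulr_ge0 ?(ltW m0)//= lerD2l.
  rewrite /m mulrA ler_pdivrMr// mulrC ler_pM2l// ler_nat ltnW//.
rewrite -sumrB; apply: le_trans (ler_norm_sum _ _ _) _.
(* Every cell may err in proportion to its volume; the [k ^ d] cells together err by [e]. *)
apply: (@le_trans _ _ (\sum_(c : {ffun 'I_d -> 'I_k}) (e / M ^+ d) * m ^+ d));
  last first.
  have E : M ^+ d = m ^+ d *+ (k ^ d).
    by rewrite -mulr_natr natrX -exprMn divfK// gt_eqF.
  by rewrite sumr_const card_ffun !card_ord -mulrnAr -E divfK ?gt_eqF.
apply: ler_sum => c _; pose a := h (v + cell_shift c m).
have near0 u w : closed_box w m u -> forall i, `|(u - w) ord0 i| < r.
  move=> cu i; have := cu i; rewrite !mxE => /andP[h1 h2].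
  by rewrite ger0_norm ?subr_ge0//; lra.
rewrite -(subrKA (box_integral (v + cell_shift c m) m (fun=> a))).
apply: le_trans (ler_normD _ _) _.
have -> : e / M ^+ d * m ^+ d = e / M ^+ d / 2 * m ^+ d + e / M ^+ d / 2 * m ^+
  d.
  by rewrite -mulrDl -splitr.
apply: lerD.
  apply: box_integral_near => // [|u cu]; first exact: cst_continuous.
  have := rH (v + cell_shift c m) (u - (v + cell_shift c m)) (cellP c) (near0 _
    _ _ cu).
  by rewrite (addrC (v + _) (u - _)) subrK.
rewrite !box_integral_cst// -(box_integral_cst (0 + cell_shift c m))//.
apply: box_integral_near => // [|u cu]; first exact: cst_continuous.
have := rH (v + cell_shift c m) (u - cell_shift c m) (cellP c).
rewrite distrC -(addrA v) (addrC (cell_shift c m)) subrK; apply.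
by apply: near0; rewrite -[cell_shift c m]add0r.
Qed.

End parameter_integrals.

(** * Compact metrizable spaces *)

(* [compact_cover] asks for a pointed space. *)
Lemma compact_finite_subcover (X : topologicalType) (I : eqType) (f : I ->
  set X) :
  compact [set: X] -> (forall x : X, exists i, nbhs x (f i)) ->
  exists s : seq I, forall x, exists2 i, i \in s & f i x.
Proof.
move=> /compact_near_coveringP cK cov.
pose F := filter_from [set: seq I] (fun s0 => [set s : seq I | {subset s0 <=
  s}]).
have FF : Filter F.
  apply: filter_from_filter; first by exists [::].
  move=> s1 s2 _ _; exists (s1 ++ s2) => // s sub; split=> i si.
    by apply: sub; rewrite mem_cat si.
  by apply: sub; rewrite mem_cat si orbT.
have [|s _ sH] := cK _ F (fun s x => exists2 i, i \in s & f i x) FF.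
  move=> x _; have [i xi] := cov x.
  exists (f i, [set s : seq I | i \in s]) => [/=|[x' s] [/= fx' si]];
    last by exists i.
  by split=> //; exists [:: i] => // s; apply; rewrite mem_head.
by exists s => x; apply: (sH s).
Qed.

Section compatible_metrics.
Variables (R : realType) (X : topologicalType).
Variables (dist : X -> X -> R) (dist_compatible : compatible_metric dist).

Lemma dist_ge0 x y : 0 <= dist x y.
Proof. by have [H _ _ _ _] := dist_compatible. Qed.

Lemma dist_refl x : dist x x = 0.
Proof. by have [_ H _ _ _] := dist_compatible; apply/H. Qed.

Lemma dist_sym x y : dist x y = dist y x.
Proof. by have [_ _ H _ _] := dist_compatible. Qed.

Lemma dist_triangle y x z : dist x z <= dist x y + dist y z.
Proof. by have [_ _ _ H _] := dist_compatible. Qed.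

Lemma dist_lip x y z : `|dist x z - dist y z| <= dist x y.
Proof.
rewrite ler_norml; have := dist_triangle x y z; have := dist_triangle y x z.
by rewrite (dist_sym y x) => h1 h2; apply/andP; split; lra.
Qed.

Lemma near_dist x (e : R) : 0 < e -> \forall y \near x, dist x y < e.
Proof. by have [_ _ _ _ H] := dist_compatible => e0; apply/H; exists e. Qed.

Lemma continuous_dist : continuous (fun p : X * X => dist p.1 p.2).
Proof.
move=> [x y]; apply/cvgrPdist_le => e e0 /=.
have e2 : 0 < e / 2 by rewrite divr_gt0.
exists ([set x' | dist x x' < e / 2], [set y' | dist y y' < e / 2]).
  by split; apply: near_dist.
move=> [x' y'] [/= h1 h2].
have -> : dist x y - dist x' y' = (dist x y - dist x' y) + (dist y x' - dist y'
  x').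
  by rewrite (dist_sym x' y) (dist_sym x' y'); ring.
apply: le_trans (ler_normD _ _) _.
by have := dist_lip x x' y; have := dist_lip y y' x'; lra.
Qed.

Hypothesis X_compact : compact [set: X].

(** A continuous function vanishing on the diagonal is small near it. With [h] another metric this
    compares two metrics; with [h] the variation of the potential it gives a modulus of
    continuity. *)
Lemma dist_uniform (h : X * X -> R) (e : R) : 0 < e -> continuous h ->
  (forall x, h (x, x) = 0) ->
  exists2 r : R, 0 < r & forall x y, dist x y < r -> h (x, y) < e.
Proof.
move=> e0 ch h0; have /compact_near_coveringP cK := X_compact.
have H := cK R (0 : R)^'+ (fun r x => forall y, dist x y < r -> h (x, y) < e) _.
have {}H : \forall r \near (0 : R)^'+, [set: X] `<=` (fun x => forall y,
  dist x y < r -> h (x, y) < e).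
  apply: H => x _.
  have /cvgrPdist_lt /(_ _ e0) := ch (x, x).
  move=> [[A1 A2] [/= xA1 xA2] sub].
  have [_ _ _ _ N] := dist_compatible.
  have /N[r r0 rA2] := xA2.
  have r2 : 0 < r / 2 by rewrite divr_gt0.
  exists (A1 `&` [set x' | dist x x' < r / 2], [set s | s < r / 2]).
    by split => /=; [apply: filterI => //;
      exact: near_dist|exact: nbhs_right_lt].
  move=> -[x' s] [/= [A1x' xx'] sr] y x'y.
  have A2y : A2 y by apply: rA2 => /=; have := dist_triangle x' x y; lra.
  have := sub (x', y) (conj A1x' A2y).
  by rewrite /= h0 sub0r normrN => /ltr_normlW.
have [r [r0 rH]] := filter_ex (filterI (nbhs_right_gt 0) H).
by exists r => // x y; apply: rH.
Qed.

Lemma finite_net (r : R) : 0 < r ->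
  exists n (p : 'I_n -> X), forall x, exists i, dist x (p i) < r.
Proof.
move=> r0; have [x|s sH] := @compact_finite_subcover _ X (fun p => [set x |
  dist x p < r]) X_compact.
  by exists x; under eq_set do rewrite dist_sym; exact: near_dist.
exists (size s), (fun i => tnth (in_tuple s) i) => x; have [p pD /= px] := sH x.
have ip : (index p s < size s)%N by rewrite index_mem.
by exists (Ordinal ip); rewrite (tnth_nth p) /= nth_index.
Qed.

End compatible_metrics.

Lemma compact_bounded_fun (R : realType) (X : topologicalType) (f : X -> R) :
  compact [set: X] -> continuous f -> exists2 B, 0 <= B & forall x, `|f x| <= B.
Proof.
move=> cX cf.
have : bounded_set (f @` [set: X]).
  by apply/compact_bounded/continuous_compact => //;
    exact: continuous_subspaceT.
move=> [B [Breal HB]]; exists (Num.max 0 (B + 1)); first by rewrite le_max lexx.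
move=> x; apply: (HB (Num.max 0 (B + 1)));
  first by rewrite lt_max ltrDl ltr01 orbT.
by exists x.
Qed.

Section bounded_sup.
Variable R : realType.

(* Unlike [ge_sup], this covers the empty set, whose supremum is 0. *)
Lemma sup_le_nneg (S : set R) (c : R) : 0 <= c -> ubound S c -> sup S <= c.
Proof.
move=> c0 Sc; have [->|/set0P S0] := eqVneq S set0; first by rewrite sup0.
exact: ge_sup.
Qed.

Lemma diam_le (X : topologicalType) (dist : X -> X -> R) (A : set X) (c : R) :
  0 <= c -> (forall x y, A x -> A y -> dist x y <= c) -> diam dist A <= c.
Proof. by move=> c0 Ac; apply: sup_le_nneg => // _ [[x y] [Ax Ay] <-];
  exact: Ac. Qed.

Lemma le_diam (X : topologicalType) (dist : X -> X ->
  R) (A : set X) (B : R) x y :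
  (forall x y, dist x y <= B) -> A x -> A y -> dist x y <= diam dist A.
Proof.
move=> dB Ax Ay; apply: ub_le_sup; last by exists (x, y).
by exists B => _ [[x' y'] _ <-].
Qed.

End bounded_sup.

(** * Orbits, potentials and width dimension *)

Lemma box_integral_subset (R : realType) (d : nat) (L L' : R)
    (h : 'rV[R]_d -> R) : 0 < L -> L <= L' -> continuous h ->
  (forall u, 0 <= h u) -> box_integral 0 L h <= box_integral 0 L' h.
Proof.
move=> L0 LL' ch h0; have L'0 : 0 < L' by exact: lt_le_trans LL'.
apply: fine_le.
- by apply: integrable_fin_num;
    [exact: measurable_row_box|exact: (integrable_box _ L0)].
- by apply: integrable_fin_num;
    [exact: measurable_row_box|exact: (integrable_box _ L'0)].
apply: ge0_subset_integral => //.
- exact: measurable_row_box.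
- exact: measurable_row_box.
- by apply/measurable_EFinP; apply: measurable_funTS; exact: measurable_fun_row.
- by move=> t _; rewrite lee_fin.
- move=> t tb i; have := tb i; rewrite !mxE; move: (tnth t i : R) => x.
  by move=> /andP[-> xL]; rewrite (lt_le_trans xL)// lerD2l.
Qed.

Section action_facts.
Variables (R : realType) (d : nat) (X : topologicalType).
Variables (T : 'rV[R]_d -> X -> X) (T_action : continuous_action T).
Implicit Types (phi : X -> R) (L M : R).

Lemma continuous_orbit phi : continuous phi ->
  continuous (fun p : 'rV[R]_d * X => phi (T p.1 p.2)).
Proof.
move=> cphi p; have [cT _ _] := T_action.
exact: (@continuous_comp _ _ _ (fun p => T p.1 p.2) phi p (cT p) (cphi _)).
Qed.

Lemma continuous_act u : continuous (T u).
Proof.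
have [cT _ _] := T_action => x A TA;
  have [[A1 A2] [/= /nbhs_singleton A1u xA2] sub] := cT (u, x) A TA.
by apply: filterS xA2 => x' A2x'; exact: (sub (u, x')).
Qed.

Lemma continuous_act_time phi x : continuous phi ->
  continuous (fun u => phi (T u x)).
Proof.
move=> cphi u A TA.
have [[A1 A2] [/= uA1 /nbhs_singleton A2x] sub] := continuous_orbit cphi (x :=
  (u, x)) TA.
by apply: filterS uA1 => u' A1u'; exact: (sub (u', x)).
Qed.

Lemma actD u v x : T (u + v) x = T u (T v x).
Proof. by have [_ _ H] := T_action. Qed.

Lemma potential_sumE phi L x :
  potential_sum T phi L x = box_integral 0 L (fun u => phi (T u x)).
Proof. exact: cube_integralE. Qed.

Lemma continuous_potential_sum phi L : 0 < L -> continuous phi ->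
  continuous (potential_sum T phi L).
Proof.
move=> L0 cphi; rewrite (_ : potential_sum T phi L = fun x => box_integral 0 L
  (fun u => phi (T u x))).
  exact: (@continuous_box_integral R d X (fun u x => phi (T u x)) 0 L L0
    (continuous_orbit cphi)).
by apply/funext => x; rewrite potential_sumE.
Qed.

Lemma potential_sum_split phi M k x : 0 < M -> (0 < k)%N -> continuous phi ->
  potential_sum T phi (k%:R * M) x =
  \sum_(c : {ffun 'I_d -> 'I_k}) potential_sum T phi M (T (cell_shift c M) x).
Proof.
move=> M0 k0 cphi; rewrite potential_sumE box_integral_split//;
  last exact: continuous_act_time.
apply: eq_bigr => c _; rewrite potential_sumE box_integral_translate//;
  last exact: continuous_act_time.
by apply: eq_box_integral => u; rewrite add0r addrC actD.
Qed.

Variables (phi : X -> R) (phi_continuous : continuous phi).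
Variables (B : R) (phiB : forall x, `|phi x| <= B).

Lemma potential_sum_bound L x : 0 < L ->
  `|potential_sum T phi L x| <= B * L ^+ d.
Proof.
move=> L0; rewrite potential_sumE -[X in `|X|]subr0 -[X in _ - X](mul0r (L ^+
  d)).
rewrite -(box_integral_cst 0 0 L0); apply: box_integral_near => //.
- exact: continuous_act_time.
- exact: cst_continuous.
- by move=> u _; rewrite subr0.
Qed.

(** Adding [B] makes the integrand nonnegative, hence its integral monotone in the cube. *)
Lemma potential_sum_le L L' x : 0 < L -> L <= L' ->
  potential_sum T phi L x <= potential_sum T phi L' x + B * (L' ^+ d - L ^+ d).
Proof.
move=> L0 LL'; have L'0 : 0 < L' by exact: lt_le_trans LL'.
have cx := continuous_act_time (x := x) phi_continuous.
have cB : continuous (fun u => phi (T u x) + B).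
  by move=> u; exact: (cvgD (cx u) (cvg_cst B)).
have := @box_integral_subset R d L L' _ L0 LL' cB _.
rewrite !box_integralD//; try exact: cst_continuous.
rewrite !box_integral_cst// -!potential_sumE mulrBr => H.
have {}H := H _; have := H _; rewrite addrA lerBrDr; apply => u.
by have := phiB (T u x); rewrite ler_norml => /andP[h _];
  rewrite -lerBlDr sub0r.
Qed.

End action_facts.

Section sup_metric.
Variables (R : realType) (d : nat) (X : topologicalType).
Variables (T : 'rV[R]_d -> X -> X) (rho : X -> X -> R) (B : R).
Hypotheses (rho_ge0 : forall x y, 0 <= rho x y) (rhoB : forall x y,
  rho x y <= B).

Lemma dist_sup_le L c x y : 0 <= c ->
  (forall u, cube L u -> rho (T u x) (T u y) <= c) -> dist_sup T rho L x y <= c.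
Proof. by move=> c0 H; apply: (sup_le_nneg c0) => _ [u cu <-]; exact: H. Qed.

Lemma le_dist_sup L x y u : cube L u ->
  rho (T u x) (T u y) <= dist_sup T rho L x y.
Proof.
move=> cu; have H : has_ubound [set rho (T v x) (T v y) | v in cube L].
  by exists B => _ [v _ <-].
by apply: (ub_le_sup H); exists u.
Qed.

Lemma dist_sup_ge0 L x y : 0 <= dist_sup T rho L x y.
Proof.
have [[u cu]|nu] := pselect (exists u : 'rV[R]_d, cube L u).
  exact: le_trans (rho_ge0 _ _) (le_dist_sup x y cu).
rewrite /dist_sup (_ : image _ _ = set0) ?sup0//.
by apply/seteqP; split => // z [u cu _]; apply: nu; exists u.
Qed.

Lemma dist_sup_bound L x y : dist_sup T rho L x y <= B.
Proof. by apply: dist_sup_le => //; exact: le_trans (rhoB x y). Qed.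

Lemma dist_sup_mono L L' x y : L <= L' ->
  dist_sup T rho L x y <= dist_sup T rho L' x y.
Proof.
move=> LL'; apply: dist_sup_le => [|u cu]; first exact: dist_sup_ge0.
by apply: le_dist_sup => i; have /andP[-> /lt_le_trans ->] := cu i.
Qed.

End sup_metric.

Section widim_facts.
Variables (R : realType) (X : topologicalType).
Implicit Types (dist : X -> X -> R) (phi : X -> R).

Lemma diam_ge0 dist (A : set X) : (forall x y, 0 <= dist x y) ->
  0 <= diam dist A.
Proof.
move=> d0; have [hS|/sup_out] := pselect (has_sup [set dist p.1 p.2 | p in A
  `*` A]).
  have [z Sz] := hS.1; apply: le_trans (sup_upper_bound hS Sz).
  by have [[x y] _ <-] := Sz; exact: d0.
by rewrite /diam => ->.
Qed.

Lemma widim_mono_eps e e' dist phi : e <= e' ->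
  (widim e' dist phi <= widim e dist phi)%E.
Proof.
move=> ee'; apply: ereal_inf_le_tmp => w [n [P [f [Pf [cf fe] ->]]]].
by exists n, P, f; split => //; split => // y; exact: lt_le_trans (fe y) ee'.
Qed.

(** An embedding for the larger metric is one for the smaller, with the same complex. The bound [B]
    makes the suprema defining diameters genuine. *)
Lemma widim_mono e dist dist' phi phi' (B c : R) :
  (forall x y, 0 <= dist' x y <= B) ->
  (forall x y, dist x y <= dist' x y) -> (forall x, phi x <= phi' x + c) ->
  (widim e dist phi <= widim e dist' phi' + c%:E)%E.
Proof.
move=> dB dd' pp'; rewrite -leeBlDr//.
apply: le_ereal_inf_tmp => _ [n [P [f [Pf [cf fe] ->]]]].
rewrite leeBlDr//.
apply: (@le_trans _ _ (ereal_sup (range (fun x => ((local_dim P (f x))%:R + phi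
  x)%:E)))).
  apply: ereal_inf_lbound; exists n, P, f; split => //; split => // y.
  apply: le_lt_trans (fe y); apply: diam_le.
    by apply: diam_ge0 => x z; case/andP: (dB x z).
  move=> x z xy zy; apply: le_trans (dd' x z) _.
  by apply: (le_diam (B := B)) => // x' z'; case/andP: (dB x' z').
apply: ge_ereal_sup => _ [x _ <-].
apply: (@le_trans _ _ (((local_dim P (f x))%:R + phi' x)%:E + c%:E)%E).
  by rewrite -EFinD lee_fin -addrA lerD2l.
by rewrite leeD2r//; apply: ereal_sup_ubound; exists x.
Qed.

Lemma widim_ge e dist phi (c : R) : [set: X] !=set0 -> (forall x, c <= phi x) ->
  (c%:E <= widim e dist phi)%E.
Proof.
move=> [x0 _] cphi; apply: le_ereal_inf_tmp => _ [n [P [f [_ _ ->]]]].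
apply: (@le_trans _ _ ((local_dim P (f x0))%:R + phi x0)%:E).
  by rewrite lee_fin (le_trans (cphi x0))// lerDr.
by apply: ereal_sup_ubound; exists x0.
Qed.

End widim_facts.

(** * Width dimension over multiples of a cube *)

Section widim_multiple.
Variables (R : realType) (d : nat) (X : topologicalType).
Hypothesis X_neq0 : [set: X] !=set0.
Variables (T : 'rV[R]_d -> X -> X) (T_action : continuous_action T).
Variables (rho : X -> X -> R) (B : R).
Hypotheses (rho_ge0 : forall x y, 0 <= rho x y) (rhoB : forall x y,
  rho x y <= B).
Variables (phi : X -> R) (phi_continuous : continuous phi).

(** The cube of side [k * M] is tiled by [k ^ d] translates of the cube of side [M]. Applying an
    embedding for the small cube along each translate gives a map to a product, where local
    dimensions add as the potential does over the tiles. *)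
Lemma widim_multiple e M k (w : R) : 0 < e -> 0 < M -> (0 < k)%N ->
  (widim e (dist_sup T rho M) (potential_sum T phi M) <= w%:E)%E ->
  (widim e (dist_sup T rho (k%:R * M)) (potential_sum T phi (k%:R * M)) <=
    (w *+ (k ^ d))%:E)%E.
Proof.
move=> e0 M0 k0 Ww; apply/lee_addgt0Pr => g g0; rewrite -EFinD.
pose g' := g / (k ^ d)%:R.
have kd0 : 0 < (k ^ d)%:R :> R by rewrite ltr0n expn_gt0 k0.
have g'0 : 0 < g' by rewrite divr_gt0.
have [_ [n [P [f [Pf [cf fe] ->]]]] supw] : exists2 w',
  [set w | exists n (P : simplicial_complex n) (f : X -> 'rV[R]_n),
    [/\ forall x, realization P (f x), eps_embedding (dist_sup T rho M) e f &
        w = ereal_sup (range (fun x => ((local_dim P (f x))%:R + potential_sum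
          T phi M x)%:E))]] w' & (w' < (w + g')%:E)%E.
  by apply/ereal_inf_lt; apply: le_lt_trans Ww _; rewrite lte_fin ltrDl.
have fw x : (local_dim P (f x))%:R + potential_sum T phi M x <= w + g'.
  rewrite -lee_fin; apply: le_trans (ltW supw).
  by apply: ereal_sup_ubound; exists x.
pose J : finType := {ffun 'I_d -> 'I_k}.
pose h (x : X) (c : J) (i : 'I_n) : R := f (T (cell_shift c M) x) ord0 i.
have hsupp x c : #|supp (h x c)| = #|vertex_support (f (T (cell_shift c M) x))|.
  apply: eq_card => i; rewrite !inE lt_neqAle eq_sym.
  by have [-> _ _] := Pf (T (cell_shift c M) x); rewrite andbT.
apply: (@widim_le_staircase _ _ J n h) => //.
- by move=> x; split => [c i|c]; have [h0 h1 _] := Pf (T (cell_shift c M) x);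
    [exact: h0|exact: h1].
- move=> c i x; apply: (@continuous_comp _ _ _ (fun x => f (T (cell_shift c M)
    x)) (fun r => r ord0 i)).
    apply: continuous_comp; first exact: continuous_act.
    exact: cf.
  exact: coord_continuous.
- move=> c.
  (* There are finitely many tiles, so the largest of the fibre diameters is still strictly below
     [e]. *)
  pose dmax := \big[Num.max/0]_(j : J) diam (dist_sup T rho M) (f @^-1` [set
    \row_i c j i]).
  have dmax_e : dmax < e by apply/bigmax_ltP.
  apply: le_lt_trans dmax_e; apply: diam_le => [|x y xc yc];
    first exact: bigmax_ge_id.
  apply: (dist_sup_le (R := R)) => [|u cu]; first exact: bigmax_ge_id.
  have [j ju] : exists j : J, cube M (u - cell_shift j M).
    have : row_box 0 (k%:R * M) (mktuple (fun i => u ord0 i)).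
      by move=> i; rewrite !mxE tnth_mktuple add0r; exact: cu.
    rewrite row_box_split// -bigcup_seq => -[j _ ju]; exists j => i.
    have := ju i; rewrite !mxE tnth_mktuple add0r => /andP[h1 h2].
    by rewrite subr_ge0 h1 ltrBlDl.
  have Tu z : T u z = T (u - cell_shift j M) (T (cell_shift j M) z).
    by rewrite -(actD T_action) subrK.
  rewrite !Tu; apply: le_trans (le_dist_sup _ rhoB _ _ ju) _.
  apply: (@le_trans _ _ (diam (dist_sup T rho M) (f @^-1` [set \row_i c j
    i]))); last first.
    by rewrite /dmax; exact: (le_bigmax _ (fun j => diam _ (f @^-1` [set \row_i
      c j i]))).
  apply: (le_diam (B := B)).
  + by move=> x' y'; exact: dist_sup_bound.
  + by apply/rowP => i; rewrite mxE; exact: xc.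
  + by apply/rowP => i; rewrite mxE; exact: yc.
- move=> x y xy; rewrite potential_sum_split// natr_sum -big_split /=.
  rewrite (_ : w *+ _ + g = (w + g') *+ #|J|); last first.
    rewrite card_ffun !card_ord mulrnDl; congr (_ + _).
    by rewrite -[RHS]mulr_natr /g' divfK// gt_eqF.
  rewrite -sumr_const; apply: ler_sum => c _;
    apply: le_trans (fw (T (cell_shift c M) x)).
  (* The support of [f] at the translate of y is a simplex containing the support at the translate
     of x, so it competes in the local dimension at x. *)
  rewrite lerD2r ler_nat hsupp.
  have [_ _ Py] := Pf (T (cell_shift c M) y).
  apply: (leq_bigmax_cond (F := fun s : {set 'I_n} => #|s|.-1)).
  rewrite Py /=; apply/fintype.subsetP => i; rewrite !inE => xi.
  apply: lt0r_neq0; apply: (xy c i).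
  by rewrite /h lt_neqAle eq_sym xi; have [-> ] := Pf (T (cell_shift c M) x).
Qed.

End widim_multiple.

(** * Limits *)

Section limits.
Variable R : realType.

(** A Fekete argument: every value bounds all later ones up to a small error, so the limit is the
    infimum. The bound [c] rules out the value [-oo]. *)
Lemma cvg_ereal_inf_pinfty (g : R -> \bar R) (c : R) :
  (forall M, 0 < M -> (c%:E <= g M)%E) ->
  (forall M (r : R), 0 < M -> 0 < r ->
    \forall L \near +oo, (g L <= g M + r%:E)%E) ->
  g L @[L --> +oo] --> ereal_inf (g @` [set M | 0 < M]).
Proof.
move=> cg gg; set I := ereal_inf _.
have IleM M : 0 < M -> (I <= g M)%E by move=> M0; apply: ereal_inf_lbound;
  exists M.
have cI : (c%:E <= I)%E by apply: le_ereal_inf_tmp => _ [M M0 <-]; exact: cg.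
have [Ioo|] := eqVneq I +oo%E.
  have goo : \forall L \near +oo, g L = +oo%E.
    near=> L; apply/eqP; rewrite -leye_eq -Ioo; apply: IleM; near: L.
    exact: nbhs_pinfty_gt.
  by rewrite Ioo; apply: cvg_near_cst.
move=> Ioo.
have Ifin : I \is a fin_num.
  by rewrite fin_numE Ioo andbT; case: I cI {Ioo IleM}.
rewrite -(fineK Ifin); apply/fine_cvgP.
have upper r : 0 < r -> \forall L \near +oo, (g L <= (fine I + r)%:E)%E.
  move=> r0; have r2 : 0 < r / 2 by rewrite divr_gt0.
  have [_ [M M0 <-] gM] : exists2 w,
    (g @` [set M | 0 < M]) w & (w < (fine I + r / 2)%:E)%E.
    by apply/ereal_inf_lt; rewrite -/I -[X in (X < _)%E](fineK Ifin) lte_fin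
      ltrDl.
  apply: filterS (gg M (r / 2) M0 r2) => L /le_trans; apply.
  by rewrite [X in fine I + X]splitr addrA EFinD leeD2r// ltW.
have lower : \forall L \near +oo, (I <= g L)%E.
  by near=> L; apply: IleM; near: L; exact: nbhs_pinfty_gt.
split.
  apply: filterS2 lower (upper 1 ltr01) => L IL Lr.
  by rewrite fin_numElt (lt_le_trans _ IL) ?(le_lt_trans Lr) ?ltry// -(fineK
    Ifin) ltNyr.
apply/cvgrPdist_le => r r0.
apply: filterS2 lower (upper r r0) => L IL Lr /=.
have gf : g L \is a fin_num.
  by rewrite fin_numElt (lt_le_trans _ IL) ?(le_lt_trans Lr) ?ltry// -(fineK
    Ifin) ltNyr.
move: IL Lr; rewrite -(fineK gf) -{1}(fineK Ifin) !lee_fin => IL Lr.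
by rewrite distrC ger0_norm ?subr_ge0// lerBlDl.
Unshelve. all: by end_near. Qed.

Lemma near_pinfty_expr (M r : R) (d : nat) : 0 < M -> 0 < r ->
  \forall L \near +oo, (1 + M / L) ^+ d - 1 < r.
Proof.
move=> M0 r0.
have /cvgrPdist_lt /(_ _ r0) := @exprn_continuous R d 1.
move=> /nbhs_ballP[e /= e0 eH].
near=> L.
have L0 : 0 < L by near: L; apply: nbhs_pinfty_gt; exact: num_real.
have Le : M / e < L by near: L; apply: nbhs_pinfty_gt; exact: num_real.
have : ball (1 : R) e (1 + M / L).
  rewrite -ball_normE /= opprD addrA subrr sub0r normrN gtr0_norm ?divr_gt0//.
  by rewrite ltr_pdivrMr// mulrC -ltr_pdivrMr.
by move=> /eH /=; rewrite expr1n distrC => /ltr_normlW.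
Unshelve. all: by end_near. Qed.

Lemma le_limf_einf (f g : R ->
  \bar R) : (\forall L \near +oo, (f L <= g L)%E) ->
  (limf_einf f (pinfty_nbhs R) <= limf_einf g (pinfty_nbhs R))%E.
Proof.
move=> fg; rewrite !limf_einfE; apply: ge_ereal_sup => _ [V FV <-].
apply: (@le_trans _ _ (ereal_inf (g @` (V `&` [set L | (f L <= g L)%E])))).
  apply: le_ereal_inf_tmp => _ [L [VL fgL] <-]; apply: le_trans fgL.
  by apply: ereal_inf_lbound; exists L.
by apply: ereal_sup_ubound; exists (V `&` [set L | (f L <= g L)%E]) => //;
  exact: filterI.
Qed.

Lemma limf_einf_lt (f : R -> \bar R) (s : \bar R) (L0 : R) :
  (limf_einf f (pinfty_nbhs R) < s)%E -> exists2 L, L0 <= L & (f L < s)%E.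
Proof.
rewrite limf_einfE => lts.
have : (ereal_inf (f @` [set L | (L0 <= L)%R]) < s)%E.
  apply: le_lt_trans lts; apply: ereal_sup_ubound.
  by exists [set L | L0 <= L] => //; apply: nbhs_pinfty_ge; exact: num_real.
by move=> /ereal_inf_lt[_ [L L0L <-] fs]; exists L.
Qed.

End limits.

(** * The limits as infima and suprema *)

Section mean_dimensions.
Variables (R : realType) (d : nat) (X : topologicalType).
Hypothesis X_neq0 : [set: X] !=set0.
Variables (T : 'rV[R]_d -> X -> X) (T_action : continuous_action T).
Variables (phi : X -> R) (phi_continuous : continuous phi).
Variables (Bphi : R) (phiB : forall x, `|phi x| <= Bphi).

Section mdim.
Variables (rho : X -> X -> R) (B : R).
Hypotheses (rho_ge0 : forall x y, 0 <= rho x y) (rhoB : forall x y,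
  rho x y <= B).

Definition widim_density (e L : R) : \bar R :=
  (widim e (dist_sup T rho L) (potential_sum T phi L) * (L ^- d)%:E)%E.

Lemma widim_density_ge e L : 0 < L -> ((- Bphi)%:E <= widim_density e L)%E.
Proof.
move=> L0; rewrite lee_pdivlMr ?exprn_gt0// -EFinM; apply: widim_ge => // x.
have := potential_sum_bound T_action phi_continuous phiB x L0.
by rewrite ler_norml mulNr => /andP[].
Qed.

(** Round L up to a multiple K of M. Enlarging the cube from L to K costs at most a multiple of K^d
    - L^d, which is small compared with L^d since K <= L + M. *)
Lemma widim_density_near e M (r : R) : 0 < e -> 0 < M -> 0 < r ->
  \forall L \near +oo, (widim_density e L <= widim_density e M + r%:E)%E.
Proof.
move=> e0 M0 r0; have Md : 0 < M ^+ d by rewrite exprn_gt0.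
have [x0 _] := X_neq0.
have Bphi0 : 0 <= Bphi by apply: le_trans (phiB x0).
have [Woo|Wfin] : widim_density e M = +oo%E \/ widim_density e M \is a fin_num.
  have := widim_density_ge e M0.
  by case: (widim_density e M) => [w _|_|//]; [right|left].
  by near=> L; rewrite Woo addye// leey.
set w := fine (widim_density e M).
have Ww : (widim e (dist_sup T rho M) (potential_sum T phi M) <= (w * M ^+
  d)%:E)%E.
  by rewrite EFinM -lee_pdivrMr// fineK.
rewrite -(fineK Wfin) -/w -EFinD.
(* The excess K^d - L^d enters once through the density [w] and once through the potential; the
   summand 1 makes [C] positive. *)
pose C := `|w| + Bphi + 1; have C0 : 0 < C by rewrite ltr_wpDl// addr_ge0.
near=> L.
have L0 : 0 < L by near: L; apply: nbhs_pinfty_gt; exact: num_real.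
have Ld : 0 < L ^+ d by rewrite exprn_gt0.
have expr_small : (1 + M / L) ^+ d - 1 < r / C.
  by near: L; apply: near_pinfty_expr => //; rewrite divr_gt0.
pose k := (Num.truncn (L / M)).+1; pose K := k%:R * M.
have LK : L <= K by rewrite -ler_pdivrMr// ltW// truncnS_gt.
have KL : K <= L + M.
  by rewrite /K -natr1 mulrDl mul1r lerD2r -ler_pdivlMr// truncn_le// divr_ge0
    ?ltW.
have K0 : 0 < K by exact: lt_le_trans LK.
rewrite lee_pdivrMr// -EFinM.
have H1 : (widim e (dist_sup T rho L) (potential_sum T phi L) <=
    widim e (dist_sup T rho K) (potential_sum T phi K) + (Bphi * (K ^+ d - L ^+
      d))%:E)%E.
  apply: (@widim_mono _ _ _ _ _ _ _ B) => [x y|x y|x].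
  - by rewrite (dist_sup_ge0 _ rho_ge0 rhoB) dist_sup_bound.
  - exact: (dist_sup_mono _ rho_ge0 rhoB).
  - exact: potential_sum_le.
apply: le_trans H1 _.
have H2 : (widim e (dist_sup T rho K) (potential_sum T phi K) <=
    (w * M ^+ d *+ (k ^ d))%:E)%E by apply: (@widim_multiple _ _ _ _ _ _ B).
apply: le_trans (leeD2r _ H2) _; rewrite -EFinD lee_fin.
have -> : w * M ^+ d *+ (k ^ d) = w * K ^+ d.
  by rewrite -mulrnAr; congr (_ * _); rewrite -mulr_natr natrX -exprMn mulrC.
have KLd : L ^+ d <= K ^+ d by rewrite lerXn2r// nnegrE ltW.
have dK : K ^+ d - L ^+ d <= r / C * L ^+ d.
  apply: (@le_trans _ _ (((1 + M / L) ^+ d - 1) * L ^+ d));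
    last by rewrite ler_pM2r// ltW.
  rewrite mulrBl mul1r lerB// -exprMn mulrDl mul1r divfK ?gt_eqF//.
  by rewrite lerXn2r// nnegrE ?addr_ge0// ltW.
have rC : (`|w| + Bphi) * (r / C) <= r.
  by rewrite mulrA ler_pdivrMr// mulrC ler_pM2l// /C lerDl.
have : (`|w| + Bphi) * (K ^+ d - L ^+ d) <= r * L ^+ d.
  apply: (@le_trans _ _ ((`|w| + Bphi) * (r / C) * L ^+ d)).
    by rewrite -mulrA ler_wpM2l// addr_ge0.
  by rewrite ler_pM2r.
have : w * (K ^+ d - L ^+ d) <= `|w| * (K ^+ d - L ^+ d).
  by rewrite ler_wpM2r ?subr_ge0// ler_norm.
rewrite !mulrDl; lra.
Unshelve. all: by end_near. Qed.

(** The limit in L is an infimum and the limit in e a supremum, so for each e a single cube with a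
    good density is enough. *)
Lemma mdim_le (D : \bar R) :
  (forall e, 0 < e -> (ereal_inf (widim_density e @` [set M | (0 < M)%R]) <=
    D)%E) ->
  (mdim T rho phi <= D)%E.
Proof.
move=> H.
pose I e := ereal_inf (widim_density e @` [set M | (0 < M)%R]).
have innerE e : 0 < e -> lim (widim_density e L @[L --> +oo%R]) = I e.
  move=> e0; apply/(cvg_lim (@ereal_hausdorff R)).
  apply: (cvg_ereal_inf_pinfty (c := - Bphi)) => [M M0|M r M0 r0].
    exact: widim_density_ge.
  exact: widim_density_near.
have : (fun e => lim (widim_density e L @[L --> +oo%R])) @ 0^'+ -->
    ereal_sup (I @` [set` `]0%R, +oo[]).
  apply: (@cvg_trans _ (I @ 0^'+)).
    apply: near_eq_cvg; near=> e; rewrite innerE//.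
  apply: nonincreasing_at_right_cvge; first by [].
  move=> e e' _ _ ee'.
  apply: le_ereal_inf_tmp => _ [M M0 <-].
  apply: (@le_trans _ _ (widim_density e' M)).
    by apply: ereal_inf_lbound; exists M.
  by rewrite lee_pmul2r// ?lte_fin ?invr_gt0 ?exprn_gt0//;
    exact: widim_mono_eps.
move=> /(cvg_lim (@ereal_hausdorff R)) mdimE; rewrite /mdim mdimE.
apply: ge_ereal_sup => _ [e + <-]; rewrite /= in_itv /= andbT; exact: H.
Unshelve. all: by end_near. Qed.

End mdim.

Lemma hausdorff_dim_mono (dist : X -> X -> R) (psi : X ->
  R) (e e' : R) : e <= e' ->
  (hausdorff_dim dist psi e' <= hausdorff_dim dist psi e)%E.
Proof.
move=> ee'; apply: ereal_inf_le_tmp => _ [s [ps cs] <-]; exists s => //;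
  split => //.
apply: le_lt_trans cs; apply: ereal_inf_le_tmp => _ [E [EX Ee ->]]; exists E.
by split => // n; exact: lt_le_trans ee'.
Qed.

(** The lower limit grows as e decreases, so the limit in e is a supremum. *)
Lemma lower_L1_mdimH_ge (dist : X -> X -> R) (e : R) : 0 < e ->
  (limf_einf (fun L : R =>
     hausdorff_dim (dist_mean T dist L) (potential_sum T phi L) e * (L ^- d)%:E)
     (pinfty_nbhs R) <= lower_L1_mdimH T dist phi)%E.
Proof.
move=> e0; rewrite /lower_L1_mdimH; set F := fun e : R => limf_einf _ _.
have : F @ 0^'+ --> ereal_sup (F @` [set` `]0%R, +oo[]).
  apply: nonincreasing_at_right_cvge; first by [].
  move=> a b _ _ ab; apply: le_limf_einf.
  near=> L; have L0 : 0 < L by near: L; exact: nbhs_pinfty_gt.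
  by rewrite lee_pmul2r// ?lte_fin ?invr_gt0 ?exprn_gt0//;
    exact: hausdorff_dim_mono.
move=> /(cvg_lim (@ereal_hausdorff R)) ->.
by apply: ereal_sup_ubound; exists e => //=; rewrite in_itv /= e0.
Unshelve. all: by end_near. Qed.

End mean_dimensions.

(** * Random breakpoints *)

Section random_breakpoints.
Variable R : realType.

(* The average of the hit penalty [lam / (1 + (lam (p - z))^2)] over p in
   [a, a+1] is at most pi, whatever lam: its primitive is an arctangent. *)
Lemma breakpoint1 (n : nat) (c lam z : 'I_n -> R) (a : R) :
  (forall i, 0 <= c i) ->
  exists2 p, a <= p <= a + 1 &
    \sum_i c i * (1 + lam i / (1 + (lam i * (p - z i)) ^+ 2)) <= (1 + pi) *
      \sum_i c i.
Proof.
move=> c0.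
pose f i (p : R) := c i * (p + atan (lam i * (p - z i))).
pose df i (p : R) := c i * (1 + lam i / (1 + (lam i * (p - z i)) ^+ 2)).
have fdf i (p : R) : is_derive p 1 (f i) (df i p).
  have lin : is_derive p (1 : R) (fun p : R => lam i * (p - z i)) (lam i).
    have := is_deriveZ (lam i) (is_deriveB (is_derive_id p (1 : R))
      (is_derive_cst (z i) p 1)).
    by rewrite subr0 [_ *: _]mulr1.
  have := @is_derive1_comp R atan (fun p => lam i * (p - z i)) p _ _
    (is_derive1_atan _) lin.
  move=> /(is_deriveD (is_derive_id p (1 : R)))/(is_deriveZ (c i)) H.
  by apply: (is_derive_eq H); rewrite /df [lam i / _]mulrC.
have Fd (p : R) : is_derive p 1 (\sum_i f i) (\sum_i df i p) by apply:
  is_derive_sum => i; exact: fdf.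
have cF : {within `[a, a + 1], continuous (\sum_i f i)}.
  by apply: derivable_within_continuous => x _; exact: ex_derive.
have a1 : a < a + 1 by rewrite ltrDl.
(* The mean value theorem produces a point where the weighted sum equals its average over [a, a+1].
   The identity contributes 1 to that average and the arctangent at most pi. *)
have [p] := MVT a1 (fun x _ => Fd x) cF.
rewrite in_itv /= => /andP[ap pa]; rewrite addrAC subrr add0r mulr1 => E.
exists p; first by rewrite !ltW.
rewrite -/(df _ _) -E !fct_sumE -sumrB mulr_sumr; apply: ler_sum => i _.
rewrite /f -mulrBr mulrC ler_wpM2r//.
have := atan_ltpi2 (lam i * (a + 1 - z i));
  have := atan_gtNpi2 (lam i * (a - z i)).
by move=> h1 h2; lra.
Qed.

(** The method of conditional expectations: the breakpoints are chosen one at a time, and the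
    factors already fixed are absorbed into the weights. Each choice costs one factor 1 + pi. *)
Lemma breakpoints (n : nat) (J : eqType) (s : seq J) (c lam : 'I_n -> R)
    (z : 'I_n -> J -> R) (a : J -> R) : (forall i, 0 <= c i) ->
      (forall i, 0 <= lam i) ->
  uniq s ->
  exists2 p : J -> R, forall j, a j <= p j <= a j + 1 &
    \sum_i c i * \prod_(j <- s) (1 + lam i / (1 + (lam i * (p j - z i j)) ^+ 2))
      <= (1 + pi) ^+ size s * \sum_i c i.
Proof.
move=> c0 lam0; elim: s => [|j s IH] /=.
  exists a; first by move=> j; rewrite lexx lerDl ler01.
  by rewrite expr0 mul1r; apply: ler_sum => i _; rewrite big_nil mulr1.
move=> /andP[js /IH[p pa ps]].
pose c' i := c i * \prod_(j <- s) (1 + lam i / (1 + (lam i * (p j - z i j)) ^+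
  2)).
have [i|q qa qs] := @breakpoint1 n c' lam (z ^~ j) (a j).
  rewrite mulr_ge0//; apply: prodr_ge0 => k _.
  by rewrite addr_ge0// divr_ge0// addr_ge0// sqr_ge0.
exists (fun k => if k == j then q else p k); first by move=> k;
  case: eqVneq => // ->.
rewrite exprS -mulrA; apply: (@le_trans _ _ ((1 + pi) * \sum_i c' i));
  last first.
  by rewrite ler_wpM2l// addr_ge0// pi_ge0.
apply: le_trans qs; rewrite le_eqVlt; apply/orP; left; apply/eqP.
apply: eq_bigr => i _; rewrite big_cons eqxx mulrCA mulrC /c' -!mulrA;
  congr (_ * (_ * _)).
by apply: eq_big_seq => k ks; rewrite ifN//; apply: contraNneq js => <-.
Qed.

(** With t = lam |y|, one has 1 + t^2 <= (1 + t)^2 <= exp(2t). The exponential form is wanted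
    because products over coordinates then see only the sum of the |y|. *)
Lemma penalty_ge (lam y : R) : 0 <= lam ->
  lam * expR (- (2 * (lam * `|y|))) <= 1 + lam / (1 + (lam * y) ^+ 2).
Proof.
move=> lam0; apply: (@le_trans _ _ (lam / (1 + (lam * y) ^+ 2)));
  last by rewrite lerDr.
rewrite ler_wpM2l// expRN lef_pV2 ?posrE ?expR_gt0//; last first.
  by rewrite ltr_pwDl// sqr_ge0.
set t := lam * `|y|; have t0 : 0 <= t by rewrite mulr_ge0.
have -> : (lam * y) ^+ 2 = t ^+ 2.
  by rewrite /t !exprMn real_normK// num_real.
rewrite mulr_natl mulr2n expRD -expr2.
apply: (@le_trans _ _ ((1 + t) ^+ 2)); last first.
  by rewrite lerXn2r ?nnegrE ?expR_ge0 ?expR_ge1Dx// addr_ge0.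
by rewrite sqrrD expr1n mul1r -addrA lerD2l lerDr mulrn_wge0.
Qed.

(** Coordinates outside [A] contribute factors at least 1; this is the purpose of the summand 1 in
    the penalty. *)
Lemma penalty_prod_ge (J : finType) (A : pred J) (lam rr : R) (y : J -> R) :
  0 <= lam -> \sum_(j | A j) `|y j| <= rr ->
  lam ^+ #|A| * expR (- (2 * (lam * rr))) <= \prod_j (1 + lam / (1 + (lam * y
    j) ^+ 2)).
Proof.
move=> lam0 yr.
have ge1 j : 1 <= 1 + lam / (1 + (lam * y j) ^+ 2).
  by rewrite lerDl divr_ge0// addr_ge0// sqr_ge0.
rewrite (bigID A) /= -[X in X <= _]mulr1.
apply: ler_pM => //; first by rewrite mulr_ge0 ?exprn_ge0 ?expR_ge0.
  apply: (@le_trans _ _ (\prod_(j | A j) (lam * expR (- (2 * (lam * `|y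
    j|)))))); last first.
    by apply: ler_prod => j _; rewrite penalty_ge// mulr_ge0// expR_ge0.
  rewrite big_split /= prodr_const ler_wpM2l ?exprn_ge0// -expR_sum ler_expR.
  by rewrite sumrN lerN2 -!mulr_sumr ler_wpM2l// ler_wpM2l.
by apply: (big_ind (fun x => 1 <= x)) => // x x' x1 x1'; rewrite mulr_ege1.
Qed.

End random_breakpoints.

(** * Intervals cut into paths *)

Section path_coordinates.
Variables (R : realType) (p : nat -> R) (kappa : R) (Q : nat).
Implicit Types (y : R).
Hypotheses (pP : forall k, 2 * k%:R <= p k <= 2 * k%:R + 1).
Hypotheses (kappa_gt0 : 0 < kappa) (kappa_le : kappa <= 4^-1).

Definition ramp k (y : R) : R := Num.max 0 (Num.min 1 ((y - p k + kappa) / (2 *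
  kappa))).

(** The shift by one gives vertex 0 no left breakpoint: vertex i covers the stretch between
    breakpoints i - 1 and i. *)
Definition level i y : R := if i is k.+1 then ramp k y else 1.

Definition path_coord (y : R) (i : 'I_Q.+1) : R := level i y - level i.+1 y.

Lemma ramp_ge0 k y : 0 <= ramp k y.
Proof. by rewrite le_max lexx. Qed.

Lemma ramp_le1 k y : ramp k y <= 1.
Proof. by rewrite ge_max ler01 ge_min lexx. Qed.

Lemma ramp_gt0 k y : 0 < ramp k y -> p k - kappa < y.
Proof.
rewrite lt_max ltxx /= lt_min => /andP[_]; rewrite pmulr_lgt0;
  first by move=> ?; lra.
by rewrite invr_gt0 mulr_gt0.
Qed.

Lemma ramp_lt1 k y : ramp k y < 1 -> y < p k + kappa.
Proof.
rewrite gt_max gt_min ltxx /= => /andP[_]; rewrite ltr_pdivrMr ?mulr_gt0//.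
by rewrite mul1r => ?; lra.
Qed.

Lemma level_le1 i y : level i y <= 1.
Proof. by case: i => [|k] /=; [exact: lexx|exact: ramp_le1]. Qed.

(** The windows [2k, 2k+1] leave gaps of length 1, so the breakpoints increase and so do the
    thresholds of the ramps. *)
Lemma level_decr i y : level i.+1 y <= level i y.
Proof.
case: i => [|k] /=; first exact: ramp_le1.
rewrite /ramp ge_max le_max lexx /= le_max; apply/orP; right.
rewrite le_min ge_min lexx /= ge_min; apply/orP; right.
rewrite ler_pM2r ?invr_gt0 ?mulr_gt0//.
have /andP[_ h1] := pP k; have /andP[h2 _] := pP k.+1.
by move: h2; rewrite -(natr1 k) mulrDr => h2; lra.
Qed.

Lemma level_homo i j y : (i <= j)%N -> level j y <= level i y.
Proof.
by move=> /subnK <-; elim: (j - i)%N => // n IH;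
  apply: le_trans (level_decr _ _) IH.
Qed.

Lemma path_coord_ge0 y i : 0 <= path_coord y i.
Proof. by rewrite subr_ge0 level_decr. Qed.

(** The sum telescopes to 1 minus the ramp at breakpoint Q, which vanishes because y stays below
    that breakpoint by more than [kappa]. *)
Lemma path_coord_sum (y : R) : y <= 2 * Q%:R - 1 -> \sum_i path_coord y i = 1.
Proof.
move=> yQ; have H n : \sum_(i < n) (level i y - level i.+1 y) = 1 - level n y.
  elim: n => [|n IH]; first by rewrite big_ord0 subrr.
  by rewrite big_ord_recr /= IH; ring.
rewrite /path_coord H /= (_ : ramp Q y = 0) ?subr0//.
have [r0|] := leP (ramp Q y) 0; first by apply/le_anti; rewrite r0 ramp_ge0.
move=> /ramp_gt0/lt_le_trans/(_ yQ) h2; have /andP[h _] := pP Q.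
by exfalso; have kl := kappa_le; lra.
Qed.

Lemma continuous_path_coord i : continuous (path_coord ^~ i).
Proof.
have cl j : continuous (level j).
  case: j => [|k]; first exact: cst_continuous.
  move=> y; apply: (@continuous_max R R (fun=> 0) (fun y => Num.min 1 ((y - p k
    + kappa) / (2 * kappa)))).
    exact: cvg_cst.
  apply: (@continuous_min R R (fun=> 1)); first exact: cvg_cst.
  have c : {for y, continuous (fun y => y - p k + kappa)}.
    exact: (cvgD (cvgB (@cvg_id _ (nbhs y)) (cvg_cst (p k))) (cvg_cst kappa)).
  exact: (cvgM c (cvg_cst _)).
by move=> y; exact: (cvgB (cl i y) (cl i.+1 y)).
Qed.

(** Two points sharing a vertex lie in an interval of length 5; this is the constant 5 in the
    closeness conditions below. *)
Lemma path_coord_loc (y : R) i : 0 <= y -> 0 < path_coord y i ->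
  2 * i%:R - 3 <= y <= 2 * i%:R + 2.
Proof.
move=> y0; rewrite subr_gt0 => h; have kl := kappa_le.
have /ramp_lt1 h1 : level i.+1 y < 1 by exact: lt_le_trans h (level_le1 _ _).
have /andP[_ h2] := pP i.
apply/andP; split; last by lra.
case: i h h1 h2 => -[|k] /= ? h h1 h2; first by rewrite mulr0; lra.
have /ramp_gt0 h3 : 0 < ramp k y by exact: le_lt_trans (ramp_ge0 _ _) h.
by have /andP[h4 _] := pP k; rewrite -(natr1 k) mulrDr; lra.
Qed.

(** Beyond the least vertex of the support, each further vertex k + 1 forces the ramp at breakpoint
    k strictly between 0 and 1, hence a hit at k. *)
Lemma card_supp_path_coord (y : R) :
  (#|supp (path_coord y)|.-1 <= #|[pred k : 'I_Q | (`|y - p k| <= kappa)%R]|)%N.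
Proof.
have [i0 i0S|S0] := pickP (supp (path_coord y)); last by rewrite eq_card0.
have [i iS imin] := arg_minnP (fun i : 'I_Q.+1 => nat_of_ord i) i0S.
set H := [pred k | _].
have : (#|supp (path_coord y)| <= #|i |: [set lift ord0 k | k in H]|)%N.
  apply: subset_leq_card; apply/fintype.subsetP => j jS.
  rewrite !inE; case: eqVneq => //= ji.
  have ij : (i < j)%N by rewrite ltn_neqAle imin// andbT eq_sym.
  have [k jk] : exists k, j = lift ord0 k.
    by case: (unliftP ord0 j) ij => [k ->|->//] _; exists k.
  rewrite jk imset_f// inE.
  move: jS iS ij; rewrite jk !inE !subr_gt0 lift0 ltnS => kS iS' ik.
  have /ramp_gt0 h1 : 0 < ramp k y by apply: le_lt_trans kS; exact: ramp_ge0.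
  have /ramp_lt1 h2 : level k.+1 y < 1.
    have ik' : (i.+1 <= k.+1)%N by rewrite ltnS.
    have iS2 : level i.+1 y < level i y by rewrite -subr_gt0.
    exact: le_lt_trans (level_homo y ik') (lt_le_trans iS2 (level_le1 _ _)).
  by rewrite ler_norml; apply/andP; split; lra.
rewrite cardsU1 => /leq_trans/(_ (leq_add (leq_b1 _) (leq_imset_card _ _))).
by rewrite add1n; case: #|supp _|.
Qed.

End path_coordinates.

(** * From Hausdorff content to width dimension *)

Section content_to_widim.
Variables (R : realType) (X : topologicalType).

(** This lets the diameter of a set of the cover, which may be 0, grow to a positive radius at
    little cost. *)
Lemma powR_lt_room (r delta a eta : R) : 0 <= r < delta -> 0 < a -> 0 < eta ->
  exists2 r', r < r' < delta & r' `^ a <= r `^ a + eta.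
Proof.
move=> /andP[r0 rd] a0 eta0; have d0 : 0 < delta by exact: le_lt_trans rd.
have rda : r `^ a < delta `^ a by rewrite gt0_ltr_powR ?nnegrE// ltW.
pose u := Num.min (r `^ a + eta) (delta `^ a).
have ru : r `^ a < u by rewrite lt_min ltrDl eta0.
pose v := (r `^ a + u) / 2.
have rv : r `^ a < v by rewrite /v; lra.
have vu : v < u by rewrite /v; lra.
have v0 : 0 <= v by apply: le_trans (ltW rv); exact: powR_ge0.
have a'0 : 0 < a^-1 by rewrite invr_gt0.
have pK x : 0 <= x -> (x `^ a) `^ a^-1 = x.
  by move=> x0; rewrite -powRrM mulfV ?gt_eqF// powRr1.
exists (v `^ a^-1).
  apply/andP; split.
    by rewrite -[X in X < _](pK r r0) gt0_ltr_powR ?nnegrE ?powR_ge0.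
  rewrite -[X in _ < X](pK delta (ltW d0)) gt0_ltr_powR ?nnegrE ?powR_ge0//.
  by apply: lt_le_trans vu _; rewrite /u ge_min lexx orbT.
rewrite -powRrM mulVf ?gt_eqF// powRr1//; apply: le_trans (ltW vu) _.
by rewrite /u ge_min lexx.
Qed.

Lemma sum_half_le1 (K : nat) : \sum_(i < K) (2^-1 : R) ^+ i.+1 <= 1.
Proof.
have -> : \sum_(i < K) (2^-1 : R) ^+ i.+1 = 1 - 2^-1 ^+ K.
  elim: K => [|K IH]; first by rewrite big_ord0 expr0 subrr.
  by rewrite big_ord_recr /= IH exprS; lra.
by rewrite lerBlDr lerDl exprn_ge0// invr_ge0.
Qed.

Hypothesis X_compact : compact [set: X].
Variables (D : X -> X -> R) (psi : X -> R) (BD Bpsi : R).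
Hypotheses (D_ge0 : forall x y, 0 <= D x y) (D_le : forall x y, D x y <= BD).
Hypothesis D_continuous : forall x, continuous (D x).
Hypotheses (psi_continuous : continuous psi) (psi_le : forall x, psi x <= Bpsi).

(* Enlarging the n-th set of the cover to an open one raises its cost by at most
   2^-(n+1), hence the bound 2 on the total cost. *)
Lemma finite_cover_of_content (s delta m : R) (x0 : X) : 0 < delta -> 0 < m ->
  sup (range psi) < s -> (hausdorff_content s delta D psi < 1)%E ->
  exists K (x : 'I_K -> X) (r a : 'I_K -> R) (used : pred 'I_K),
    [/\ forall i, 0 < r i < delta, forall i, used i -> 0 < a i,
        \sum_(i | used i) r i `^ a i <= 2 &
        forall y, exists2 i, used i & D (x i) y < r i /\ a i + psi y < s + m].
Proof.
move=> delta0 m0 psi_s /ereal_inf_lt[_ [E [EX Edelta ->]]] cost.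
pose a n := s - sup (psi @` E n).
pose term n := hausdorff_term D psi s (E n).
have supE n : has_ubound (psi @` E n).
  by exists Bpsi => _ [x _ <-].
have term0 n : 0 <= term n.
  by rewrite /term /hausdorff_term; case: ifP => // _; exact: powR_ge0.
have aE n : E n !=set0 -> 0 < a n.
  move=> En0; rewrite subr_gt0; apply: le_lt_trans psi_s.
  apply: ge_sup => [|_ [x _ <-]]; first by have [x Ex] := En0; exists (psi x);
    exists x.
  by apply: ub_le_sup; [exists Bpsi => _ [z _ <-]|exists x].
have H n : exists xr : X * R, 0 < xr.2 < delta /\ (E n !=set0 ->
    [/\ E n xr.1, diam D (E n) < xr.2 & xr.2 `^ a n <= term n + 2^-1 ^+ n.+1]).
  have [[x Ex]|En0] := pselect (E n !=set0); last first.
    (* Empty sets get a dummy centre and radius, and [used] excludes them later. *)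
    by exists (x0, delta / 2) => /=; split => //; rewrite divr_gt0//=; lra.
  have En0 : E n !=set0 by exists x.
  have diam0 : 0 <= diam D (E n) by exact: diam_ge0.
  have rlt : 0 <= diam D (E n) < delta by rewrite diam0 Edelta.
  have eta0 : 0 < (2^-1 : R) ^+ n.+1 by rewrite exprn_gt0// invr_gt0.
  have [r' /andP[rr' r'd] r'a] := powR_lt_room rlt (aE n En0) eta0.
  exists (x, r') => /=; rewrite (le_lt_trans diam0 rr') r'd; split => // _;
    split => //.
  by rewrite /term /hausdorff_term ifF//; apply/negbTE/set0P.
have /choice[xr xrP] := H.
(* An open enlargement of [E n]: the radius exceeds the diameter, and the potential may exceed its
   supremum on [E n] by less than [m]. *)
pose f n := [set y | E n !=set0 /\ (D (xr n).1 y < (xr n).2 /\ a n + psi y < s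
  + m)].
have [x|ns nsP] := @compact_finite_subcover X nat f X_compact.
  have [n _ Enx] : (\bigcup_n E n) x by rewrite EX.
  have En0 : E n !=set0 by exists x.
  have [_ /(_ En0)[Ex1 diamr _]] := xrP n.
  exists n; apply: filterS (_ : nbhs x (fun y => D (xr n).1 y < (xr n).2 /\ a n
    + psi y < s + m)).
    by move=> y h; split.
  apply: filterI.
    have Dx : D (xr n).1 x < (xr n).2.
      by apply: le_lt_trans diamr; apply: (le_diam D_le).
    by have /cvgr_lt/(_ _ Dx) := @D_continuous (xr n).1 x.
  have psix : psi x < s + m - a n.
    have : psi x <= sup (psi @` E n) by apply: ub_le_sup => //; exists x.
    by rewrite /a => ?; lra.
  have : \forall y \near x, psi y < s + m - a n.
    by have /cvgr_lt/(_ _ psix) := @psi_continuous x.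
  by apply: filterS => y; rewrite ltrBrDl.
pose K := (\max_(n <- ns) n).+1.
pose used : pred 'I_K := fun i => `[< E i !=set0 >].
exists K, (fun i => (xr i).1), (fun i => (xr i).2), (fun i => a i), used; split.
- by move=> i; have [] := xrP i.
- by move=> i /asboolP; exact: aE.
- apply: (@le_trans _ _ (\sum_(i < K) (term i + 2^-1 ^+ i.+1))).
    rewrite big_mkcond; apply: ler_sum => i _; case: ifPn => [/asboolP En0|_].
      by have [_ /(_ En0)[]] := xrP i.
    by rewrite addr_ge0// exprn_ge0// invr_ge0.
  rewrite big_split /= -[leRHS]/(1 + 1) lerD ?sum_half_le1//.
  rewrite -lee_fin; apply: le_trans (ltW cost).
  rewrite -sumEFin -(big_mkord xpredT (fun i => (term i)%:E)).
  by apply: nneseries_lim_ge => n _; rewrite lee_fin.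
move=> y; have [n nns [En0 Dpsi]] := nsP y.
have nK : (n < K)%N by rewrite ltnS; apply: leq_bigmax_seq.
by exists (Ordinal nK) => //; apply/asboolP.
Qed.

End content_to_widim.

Section widim_of_content.
Variables (R : realType) (X : topologicalType).
Hypothesis X_compact : compact [set: X].
Variables (D : X -> X -> R) (psi : X -> R) (BD Bpsi : R).
Hypotheses (D_ge0 : forall x y, 0 <= D x y) (D_le : forall x y, D x y <= BD).
Hypothesis D_continuous : forall x, continuous (D x).
Hypotheses (psi_continuous : continuous psi) (psi_le : forall x, psi x <= Bpsi).
Variables (J : finType) (F : J -> X -> R) (Q : nat) (C : R).
Hypothesis C_ge0 : 0 <= C.
Hypothesis F_continuous : forall j, continuous (F j).
Hypothesis F_ran : forall j x, 0 <= F j x <= 2 * Q%:R - 1.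
Hypothesis F_lip : forall x y, \sum_j `|F j x - F j y| <= C * D x y.

(* The union bound over the cover, derandomised by [breakpoints]. *)
Lemma breakpoints_few_hits (s delta m : R) (x0 : X) : 0 < delta <= 1 -> 0 < m ->
  sup (range psi) < s -> (hausdorff_content s delta D psi < 1)%E ->
  (1 + pi) ^+ (#|J| * Q) * (2 * delta `^ m) < expR (- (2 * (#|J|%:R + C))) ->
  exists (p : J -> nat -> R) (kappa : R),
    [/\ forall j k, 2 * k%:R <= p j k <= 2 * k%:R + 1, 0 < kappa <= 4^-1 &
      forall y, (\sum_j #|[pred k : 'I_Q | (`|F j y - p j k| <= kappa)%R]|)%:R
        + psi y
        <= s + 2 * m].
Proof.
move=> /andP[delta0 delta1] m0 psi_s cost small.
have [K [x [r [a [used [rdelta a0 ra cover]]]]]] :=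
  finite_cover_of_content X_compact D_ge0 D_le D_continuous psi_continuous
    psi_le
    x0 delta0 m0 psi_s cost.
have r0 i : 0 < r i by case/andP: (rdelta i).
have rle1 i : r i <= 1 by case/andP: (rdelta i) => _ /ltW/le_trans; apply.
(* The extra factor r^m is at most delta^m; it makes the total weight small enough to beat the
   constants exponential in [#|J|]. *)
pose c i := if used i then r i `^ (a i + m) else 0.
have c0 i : 0 <= c i by rewrite /c; case: ifP => // _; exact: powR_ge0.
have sumc : \sum_i c i <= 2 * delta `^ m.
  rewrite /c -big_mkcond /=;
    apply: (@le_trans _ _ ((\sum_(i | used i) r i `^ a i) * delta `^ m)).
    rewrite mulr_suml; apply: ler_sum => i _.
    rewrite powRD; last by rewrite (gt_eqF (r0 i)) implybT.
    rewrite ler_wpM2l ?powR_ge0// ge0_ler_powR ?nnegrE ?(ltW m0) ?(ltW delta0)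
      ?(ltW (r0 i))//.
    by case/andP: (rdelta i) => _ /ltW.
  by rewrite ler_wpM2r ?powR_ge0.
pose lam i := (r i)^-1.
have lam0 i : 0 <= lam i by rewrite invr_ge0 ltW.
have [p0 p0P p0sum] := @breakpoints R K (J * 'I_Q)%type (enum {: J * 'I_Q}) c
  lam
  (fun i jk => F jk.1 (x i)) (fun jk => 2 * (jk.2 : nat)%:R) c0 lam0 (enum_uniq
    _).
pose p j k := if insub k is Some k' then p0 (j, k' : 'I_Q) else 2 * k%:R.
have pE j (k : 'I_Q) : p j k = p0 (j, k) by rewrite /p valK.
have pP j k : 2 * k%:R <= p j k <= 2 * k%:R + 1.
  by rewrite /p; case: insubP => [k' _ <-|_];
    [exact: (p0P (j, k'))|rewrite lexx lerDl ler01].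
(* A hit within [kappa] is then a hit within the radius of whichever set contains the point. *)
pose kappa := \big[Num.min/4^-1]_i r i.
have kr i : kappa <= r i by exact: bigmin_le.
exists p, kappa; split => //.
  by rewrite bigmin_le_id andbT; apply/bigmin_gtP; split => //;
    rewrite invr_gt0.
have kle : kappa <= 4^-1 by exact: bigmin_le_id.
move=> y; pose A := [pred jk : J * 'I_Q | `|F jk.1 y - p0 jk| <= kappa].
pose hits j := [pred k : 'I_Q | (`|F j y - p j k| <= kappa)%R].
(* Distinct breakpoints of one coordinate are at least 1 apart, while 2 [kappa] is at most 1/2. *)
have hits1 j : (#|hits j| <= 1)%N.
  apply/card_le1P => k; rewrite inE => hk k'; rewrite inE.
  apply/idP/idP => [hk'|/eqP ->//]; apply/eqP/val_inj/eqP.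
  have := pP j k; have := pP j k'; move: hk hk'.
  rewrite !ler_norml => /andP[h1 h2] /andP[h3 h4] /andP[h5 h6] /andP[h7 h8].
  by case: (ltngtP k' k) => // lt; exfalso;
    move: lt; rewrite -(ler_nat R) -natr1 => lt; lra.
have sumA (w : J -> R) : (forall j, 0 <= w j) ->
  \sum_(jk | A jk) w jk.1 <= \sum_j w j.
  move=> w0; rewrite (eq_bigl (fun jk => predT jk.1 && hits jk.1 jk.2));
    last first.
    by move=> [j k] /=; rewrite pE.
  rewrite -(pair_big_dep xpredT (fun j k => hits j k) (fun j _ => w j)) /=.
  apply: ler_sum => j _; rewrite sumr_const -[leRHS]mulr1n ler_wpMn2l//.
  exact: hits1.
have cardA : #|A| = (\sum_j #|hits j|)%N.
  rewrite -sum1_card (eq_bigl (fun jk => predT jk.1 && hits jk.1 jk.2));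
    last first.
    by move=> [j k] /=; rewrite inE /= pE.
  rewrite -(pair_big_dep xpredT (fun j k => hits j k) (fun _ _ => 1%N)) /=.
  by apply: eq_bigr => j _; rewrite sum1_card.
rewrite -cardA; have [i ui [Dy psiy]] := cover y.
suff : #|A|%:R < a i + m by move=> h; lra.
rewrite ltNge; apply/negP => mA.
(* A hit at y is moved to the centre [x i]: at most one hit per coordinate costs [r i] each, and the
   Lipschitz bound adds [C * r i] in all. *)
have AD : \sum_(jk | A jk) `|p0 jk - F jk.1 (x i)| <= (#|J|%:R + C) * r i.
  apply: (@le_trans _ _ (\sum_(jk | A jk) (r i + `|F jk.1 (x i) - F jk.1 y|))).
    apply: ler_sum => jk Ajk; rewrite -(subrKA (F jk.1 y)).
    apply: le_trans (ler_normD _ _) _; rewrite distrC [X in _ + X]distrC lerD2r.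
    exact: le_trans Ajk (kr i).
  apply: le_trans (sumA (fun j => r i + `|F j (x i) - F j y|) _) _.
    by move=> j; rewrite addr_ge0 ?(ltW (r0 i)).
  have -> : (#|J|%:R + C) * r i = \sum_(j : J) r i + C * r i.
    by rewrite sumr_const mulrDl mulr_natl.
  rewrite big_split /= lerD2l.
  by apply: le_trans (F_lip _ _) _; rewrite ler_wpM2l// ltW.
have lamr : lam i * ((#|J|%:R + C) * r i) = #|J|%:R + C.
  by rewrite mulrCA /lam mulVf ?mulr1// gt_eqF.
have := penalty_prod_ge (lam0 i) AD; rewrite lamr => prodge.
(* With at least a + m hits, the weight r^(a+m) is compensated by lam^#|A| with lam = 1/r and r <=
   1, so this single term already violates [small]. *)
have : expR (- (2 * (#|J|%:R + C))) <= c i * \prod_jk (1 + lam i / (1 + (lam i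
  * (p0 jk - F jk.1 (x i))) ^+ 2)).
  apply: le_trans (ler_wpM2l (c0 i) prodge); rewrite mulrA -[X in X <= _]mul1r.
  rewrite ler_wpM2r ?expR_ge0// /c ui /lam exprVn -powR_mulrn ?(ltW (r0 i))//.
  rewrite ler_pdivlMr ?powR_gt0// mul1r; apply: ger_powR => //.
  by rewrite r0 rle1.
apply/negP; rewrite -ltNge; apply: le_lt_trans small.
apply: (@le_trans _ _ (\sum_i c i * \prod_(j <- enum {: J * 'I_Q}) (1 + lam i /
  (1 + (lam i * (p0 j - F j.1 (x i))) ^+ 2)))).
  rewrite (bigD1 i)//= big_enum /= lerDl; apply: sumr_ge0 => k _.
  rewrite mulr_ge0//; apply: prodr_ge0 => jk _.
  by rewrite addr_ge0// divr_ge0// addr_ge0// sqr_ge0.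
apply: le_trans p0sum _; rewrite -cardE card_prod card_ord ler_wpM2l//.
by rewrite exprn_ge0// addr_ge0// pi_ge0.
Qed.

(** Of the three [m], the first pays for the variation of the potential on a set of the cover, the
    second for the weight surplus r^m, and the third for comparing the potential at x with that at
    the point y whose support gives the dimension. *)
Lemma widim_le_of_content (s delta m e e' : R) (rho : X -> X -> R) (x0 : X) :
  0 < delta <= 1 -> 0 < m -> 0 <= e' -> e' < e ->
  sup (range psi) < s -> (hausdorff_content s delta D psi < 1)%E ->
  (1 + pi) ^+ (#|J| * Q) * (2 * delta `^ m) < expR (- (2 * (#|J|%:R + C))) ->
  (forall x y, (forall j, `|F j x - F j y| <= 5) ->
     rho x y <= e' /\ psi x <= psi y + m) ->
  (widim e rho psi <= (s + 3 * m)%:E)%E.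
Proof.
move=> delta01 m0 e'0 e'e psi_s cost small close.
have [p [kappa [pP /andP[k0 kle] hits]]] :=
  breakpoints_few_hits x0 delta01 m0 psi_s cost small.
pose h x j := @path_coord R (p j) kappa Q (F j x).
have hprob x : prob_vectors (h x).
  split=> [j i|j]; first exact: path_coord_ge0.
  by apply: path_coord_sum => //; case/andP: (F_ran j x).
have near x y : (forall j i, 0 < h x j i -> 0 < h y j i) ->
    forall j, `|F j x - F j y| <= 5.
  move=> xy j; have [i hi] : exists i, 0 < h x j i.
    apply/not_existsP => hi0; have := (hprob x).2 j; rewrite big1 => [/eqP|i _].
      by rewrite eq_sym oner_eq0.
    have /negP := hi0 i; rewrite -leNgt => hi; apply/le_anti.
    by rewrite hi (hprob x).1.
  have /andP[Fx0 _] := F_ran j x; have /andP[Fy0 _] := F_ran j y.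
  have /andP[h1 h2] := path_coord_loc (pP j) k0 kle Fx0 hi.
  have /andP[h3 h4] := path_coord_loc (pP j) k0 kle Fy0 (xy j i hi).
  by rewrite ler_norml; apply/andP; split; lra.
apply: (@widim_le_staircase _ _ J Q.+1 h) => //.
- exact: le_lt_trans e'e.
- move=> j i x; apply: (@continuous_comp _ _ _ (F j) (fun y => path_coord (p j)
    kappa y i)).
    exact: F_continuous.
  exact: continuous_path_coord.
- move=> c; apply: le_lt_trans e'e; apply: diam_le => // x y xc yc.
  have hxy j i : 0 < h x j i -> 0 < h y j i by rewrite xc yc.
  by have [] := close x y (near x y hxy).
- move=> x y xy; have [_ psixy] := close x y (near x y xy).
  have := hits y; set N := (X in X%:R + _ <= s + _ -> _).
  have : (\sum_j #|supp (h y j)|.-1)%:R <= N%:R :> R.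
    by rewrite ler_nat; apply: leq_sum => j _; exact: card_supp_path_coord.
  lra.
Qed.

End widim_of_content.

(** * Mean metrics and averages over cells *)

Section mean_metric.
Variables (R : realType) (d : nat) (X : topologicalType).
Hypothesis X_compact : compact [set: X].
Variables (T : 'rV[R]_d -> X -> X) (T_action : continuous_action T).
Variables (dist : X -> X -> R) (dist_compatible : compatible_metric dist).
Variables (B : R) (dist_le : forall x y, dist x y <= B).

Let d_ge0 := dist_ge0 dist_compatible.

Lemma continuous_dist_orbits x :
  continuous (fun p : 'rV[R]_d * X => dist (T p.1 x) (T p.1 p.2)).
Proof.
have [cT _ _] := T_action; move=> [u y] /=.
have c1 : (fun p : 'rV[R]_d * X => T p.1 x) @ (u, y) --> T u x.
  move=> A TA; have [[A1 A2] [/= uA1 /nbhs_singleton A2x] sub] := cT (u,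
    x) A TA.
  by exists (A1, setT) => [|[u' y'] [/= A1u' _]]; [split=> //;
    exact: filterT|exact: (sub (u', x))].
have c2 : (fun p : 'rV[R]_d * X => T p.1 p.2) @ (u, y) --> T u y := cT (u, y).
apply: (@continuous_comp ('rV[R]_d * X)%type (X * X)%type R
  (fun q => (T q.1 x, T q.1 q.2)) (fun q => dist q.1 q.2)).
  exact: (cvg_pair c1 c2).
exact: continuous_dist.
Qed.

Lemma continuous_dist_orbit x y : continuous (fun u => dist (T u x) (T u y)).
Proof.
move=> u A TA.
have [[A1 A2] [/= uA1 /nbhs_singleton A2y] sub] := @continuous_dist_orbits x
  (u, y) A TA.
by apply: filterS uA1 => u' A1u'; exact: (sub (u', y)).
Qed.

Lemma dist_meanE L x y :
  dist_mean T dist L x y = L ^- d * box_integral 0 L (fun u => dist (T u x) (T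
    u y)).
Proof. by rewrite /dist_mean cube_integralE. Qed.

Lemma dist_mean_ge0 L x y : 0 < L -> 0 <= dist_mean T dist L x y.
Proof.
move=> L0; rewrite dist_meanE mulr_ge0 ?invr_ge0 ?exprn_ge0 ?(ltW L0)//.
exact: Rintegral_ge0.
Qed.

Lemma dist_mean_le L x y : 0 < L -> dist_mean T dist L x y <= B.
Proof.
move=> L0; rewrite dist_meanE mulrC ler_pdivrMr ?exprn_gt0// -(box_integral_cst
  0 B L0).
by apply: box_integral_le => //;
  [exact: continuous_dist_orbit|exact: cst_continuous].
Qed.

Lemma continuous_dist_mean L x : 0 < L -> continuous (dist_mean T dist L x).
Proof.
move=> L0; rewrite (_ : dist_mean T dist L x = fun y => L ^- d * box_integral 0
  L (fun u => dist (T u x) (T u y))).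
  move=> y; apply: cvgM; first exact: cvg_cst.
  exact: (@continuous_box_integral R d X (fun u y => dist (T u x) (T u y)) 0 L
    L0 (@continuous_dist_orbits x)).
by apply/funext => y; rewrite dist_meanE.
Qed.

Lemma continuous_dist_pt p : continuous (fun x => dist x p).
Proof.
move=> x; apply/cvgrPdist_lt => e e0.
apply: filterS (near_dist dist_compatible x e0) => y /=.
exact: le_lt_trans (dist_lip dist_compatible x y p).
Qed.

Lemma act_modulus (w : R) : 0 < w ->
  exists2 r : R, 0 < r & forall v : 'rV[R]_d, (forall i, `|v ord0 i| < r) ->
    forall z, dist (T v z) z < w.
Proof.
move=> w0; have /compact_near_coveringP cK := X_compact.
have H := cK 'rV[R]_d (nbhs (0 : 'rV[R]_d)) (fun v z => dist (T v z) z < w)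
  (nbhs_filter _).
have /nbhs_ballP[r /= r0 rH] :
    \forall v \near (0 : 'rV[R]_d), [set: X] `<=` (fun z => dist (T v z) z < w).
  apply: H => z _; have [cT T0 _] := T_action.
  have w2 : 0 < w / 2 by rewrite divr_gt0.
  have H1 := near_dist dist_compatible z w2.
  have := cT (0, z) [set y | dist z y < w / 2]; rewrite /= T0 => /(_ H1).
  move=> [[A1 A2] [/= A1_0 A2z] sub].
  exists (A2 `&` [set y | dist z y < w / 2], A1) => /=; first by split=> //;
    exact: filterI.
  move=> [z' v] [/= [A2z' zz'] A1v]; have /= := sub (v, z') (conj A1v A2z').
  have := dist_triangle dist_compatible z (T v z') z'.
  by rewrite (dist_sym dist_compatible (T v z') z) => h1 h2; lra.
exists r => // v vr z; apply: rH => //.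
by split => // i j; rewrite ord1 -ball_normE /= mxE sub0r normrN.
Qed.

End mean_metric.

Section cell_averages.
Variables (R : realType) (d : nat) (X : topologicalType).
Variables (T : 'rV[R]_d -> X -> X) (T_action : continuous_action T).
Variables (dist : X -> X -> R) (dist_compatible : compatible_metric dist).
Variables (B : R) (dist_le : forall x y, dist x y <= B).
Variables (L zeta : R) (K M : nat) (p : 'I_M -> X).
Hypotheses (L_gt0 : 0 < L) (zeta_gt0 : 0 < zeta) (K_gt0 : (0 < K)%N).

Let eta := L / K%:R.
Let cells : finType := {ffun 'I_d -> 'I_K}.
Let eta_gt0 : 0 < eta. Proof. by rewrite divr_gt0// ltr0n. Qed.
Let LE : L = K%:R * eta.
Proof. by rewrite mulrC divfK// pnatr_eq0 -lt0n. Qed.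
Let etad_gt0 : 0 < eta ^+ d. Proof. by rewrite exprn_gt0// eta_gt0. Qed.
Let dist_pt_time i x : continuous (fun u => dist (T u x) (p i)).
Proof. exact: (continuous_act_time T_action (@continuous_dist_pt _ _ _
  dist_compatible (p i))). Qed.

(** Distances are measured in units of [zeta], so that the resolution 5 of the paths means a
    distance [5 * zeta]. *)
Definition cell_average (j : cells * 'I_M) (x : X) : R :=
  (zeta * eta ^+ d)^-1 *
  box_integral (cell_shift j.1 eta) eta (fun u => dist (T u x) (p j.2)).

Let scale_gt0 : 0 < zeta * eta ^+ d.
Proof. by rewrite mulr_gt0 ?zeta_gt0 ?etad_gt0. Qed.

Lemma continuous_cell_average j : continuous (cell_average j).
Proof.
move=> x; apply: cvgM; first exact: cvg_cst.
exact: (@continuous_box_integral R d X (fun u x => dist (T u x) (p j.2)) _ _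
  eta_gt0
  (continuous_orbit T_action (@continuous_dist_pt _ _ _ dist_compatible (p
    j.2)))).
Qed.

Lemma cell_average_ge0 j x : 0 <= cell_average j x.
Proof.
rewrite mulr_ge0 ?invr_ge0 ?(ltW scale_gt0)//; apply: Rintegral_ge0 => t _.
exact: dist_ge0.
Qed.

Lemma cell_average_le j x : cell_average j x <= B / zeta.
Proof.
rewrite /cell_average mulrC ler_pdivrMr ?scale_gt0// mulrA divfK ?gt_eqF
  ?zeta_gt0//.
rewrite -(box_integral_cst (cell_shift j.1 eta) B eta_gt0).
by apply: (box_integral_le eta_gt0) => //; exact: cst_continuous.
Qed.

(** On each cell the triangle inequality removes the net point; summing over cells restores the
    integral over the whole cube, once for each net point. *)
Lemma cell_average_lip x y : \sum_j `|cell_average j x - cell_average j y| <=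
  #|{: cells * 'I_M}|%:R / zeta * dist_mean T dist L x y.
Proof.
apply: (@le_trans _ _ (\sum_(j : cells * 'I_M) (zeta * eta ^+ d)^-1 *
    box_integral (cell_shift j.1 eta) eta (fun u => dist (T u x) (T u y)))).
  apply: ler_sum => j _; rewrite -mulrBr normrM gtr0_norm ?invr_gt0
    ?scale_gt0//.
  rewrite ler_pM2l ?invr_gt0 ?scale_gt0// -(box_integralB _ eta_gt0);
    try exact: dist_pt_time.
  have cB : continuous (fun u => dist (T u x) (p j.2) - dist (T u y) (p j.2)).
    by move=> u; exact: (cvgB (@dist_pt_time j.2 x u) (@dist_pt_time j.2 y u)).
  apply: le_trans (le_norm_box_integral _ eta_gt0 cB) _.
  apply: (box_integral_le eta_gt0) => [u||u _].
  - exact: (cvg_norm (cB u)).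
  - exact: (@continuous_dist_orbit _ _ _ T T_action dist dist_compatible x y).
  - exact: (dist_lip dist_compatible).
rewrite -mulr_sumr.
rewrite -(pair_big xpredT xpredT (fun (c : cells) (i : 'I_M) =>
   box_integral (cell_shift c eta) eta (fun u => dist (T u x) (T u y)))) /=.
under eq_bigr do rewrite sumr_const card_ord.
rewrite sumrMnl.
have <- : box_integral 0 L (fun u => dist (T u x) (T u y)) =
   \sum_(c : cells) box_integral (cell_shift c eta) eta (fun u => dist (T u x)
     (T u y)).
  rewrite LE box_integral_split ?eta_gt0//;
    last exact: (@continuous_dist_orbit _ _ _ T T_action dist dist_compatible x
    y).
  by apply: eq_bigr => c _; rewrite add0r.
rewrite dist_meanE card_prod card_ord card_ffun !card_ord natrM natrX.
set I := box_integral _ _ _.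
have -> : L ^- d = (K%:R ^+ d)^-1 * (eta ^+ d)^-1 by rewrite LE exprMn invfM.
have Kd : K%:R ^+ d != 0 :> R by rewrite expf_neq0// pnatr_eq0 -lt0n.
rewrite -mulr_natl invfM le_eqVlt; apply/orP; left; apply/eqP.
have ed := lt0r_neq0 etad_gt0; have z := lt0r_neq0 zeta_gt0.
by field; rewrite mulr1 ed Kd z.
Qed.

(** Take the net point near [T u x]. Replacing a distance at time u by its cell average costs [om]
    for x and for y, and the distance to the net point is paid twice: [4 * om] in all. *)
Lemma cell_average_close (x y : X) (u : 'rV[R]_d) (om : R) :
  (forall v : 'rV[R]_d, (forall i, `|v ord0 i| <= eta) ->
    forall z, dist (T v z) z <= om) ->
  (forall z, exists i, dist z (p i) <= om) ->
  (forall j, `|cell_average j x - cell_average j y| <= 5) -> cube L u ->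
  dist (T u x) (T u y) <= 4 * om + 5 * zeta.
Proof.
move=> mod net close cu.
have om0 : 0 <= om by have [i] := net x; apply: le_trans; exact: dist_ge0.
have [c uc] : exists c : cells, forall i,
  (cell_shift c eta) ord0 i <= u ord0 i < (cell_shift c eta) ord0 i + eta.
  have : row_box 0 (K%:R * eta) (mktuple (fun i => u ord0 i)).
    by move=> i; rewrite !mxE tnth_mktuple add0r -LE; exact: cu.
  rewrite (row_box_split _ _ eta_gt0) -bigcup_seq => -[c _ uc]; exists c => i.
  by have := uc i; rewrite !mxE tnth_mktuple add0r.
have avg i z : `|zeta * cell_average (c, i) z - dist (T u z) (p i)| <= om.
  have -> : zeta * cell_average (c, i) z =
      box_integral (cell_shift c eta) eta (fun v => dist (T v z) (p i)) / eta
        ^+ d.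
    rewrite /cell_average /= invfM mulrA mulrA mulfV ?mul1r 1?mulrC//.
    by rewrite gt_eqF ?zeta_gt0.
  have -> : dist (T u z) (p i) = box_integral (cell_shift c eta) eta (fun=>
    dist (T u z) (p i)) / eta ^+ d.
    by rewrite box_integral_cst ?eta_gt0// mulfK// gt_eqF ?etad_gt0.
  rewrite -mulrBl normrM [X in _ * X]gtr0_norm ?invr_gt0 ?etad_gt0//.
  rewrite ler_pdivrMr ?etad_gt0//; apply: box_integral_near; rewrite ?eta_gt0//.
    exact: cst_continuous.
  move=> v cv; apply: le_trans (dist_lip dist_compatible _ _ _) _.
  rewrite -[v in T v z](subrK u) (actD T_action); apply: mod => k.
  rewrite !mxE; have := uc k; have := cv k; move=> /andP[h1 h2] /andP[h3 h4].
  by rewrite ler_norml; apply/andP; split; lra.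
have [i xi] := net (T u x).
have h1 := avg i x; have h2 := avg i y; have h3 := close (c, i).
have h4 : `|zeta * cell_average (c, i) x - zeta * cell_average (c,
  i) y| <= 5 * zeta.
  by rewrite -mulrBr normrM gtr0_norm ?zeta_gt0// mulrC ler_pM2r ?zeta_gt0.
have := dist_triangle dist_compatible (p i) (T u x) (T u y).
rewrite (dist_sym dist_compatible (p i)).
move: h1 h2 h4; rewrite !ler_norml => /andP[a1 a2] /andP[a3 a4] /andP[a5 a6]
  h5; lra.
Qed.

End cell_averages.

(** * Choice of constants and conclusion *)

Section mean_content_to_widim.
Variable R : realType.

Lemma compatible_metric_bounded (X : topologicalType) (dist : X -> X -> R) :
  compact [set: X] -> compatible_metric dist ->
    exists B, forall x y, dist x y <= B.
Proof.
move=> X_compact dist_compatible.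
have [[x0 _]|X0] := pselect ([set: X] !=set0); last first.
  by exists 0 => x; exfalso; apply: X0; exists x.
have [B _ dB] := compact_bounded_fun X_compact (@continuous_dist_pt _ _ _
  dist_compatible x0).
exists (2 * B) => x y; have := dist_triangle dist_compatible x0 x y.
rewrite (dist_sym dist_compatible x0 y).
have := ler_norm (dist x x0); have := ler_norm (dist y x0).
by have := dB x; have := dB y; lra.
Qed.

(** Here a is L^d and N the number of coordinates. From 1 + pi <= exp(pi) and 2 <= exp(a), the claim
    reduces to N q + a < (C0 q + 2) a with q = pi Q + 2 (1 + z); the summand 2 pays for the factor 2
    and leaves the strict gap. *)
Lemma exp_smallness (N Q : nat) (z tau a C0 : R) : 0 < tau -> 1 <= a ->
  0 <= z ->
  N%:R <= C0 * a ->
  (1 + pi) ^+ (N * Q) *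
    (2 * expR (- (C0 * (pi * Q%:R + 2 * (1 + z)) + 2) / tau) `^ (tau * a)) <
  expR (- (2 * (N%:R + N%:R * z))).
Proof.
move=> tau0 a1 z0 NC.
have powE : expR (- (C0 * (pi * Q%:R + 2 * (1 + z)) + 2) / tau) `^ (tau * a) =
    expR (- (C0 * (pi * Q%:R + 2 * (1 + z)) + 2) * a).
  rewrite /powR gt_eqF ?expR_gt0// expRK; congr expR.
  by field; rewrite gt_eqF.
rewrite powE.
have h1 : (1 + pi) ^+ (N * Q) <= expR (N%:R * (pi * Q%:R)) :> R.
  apply: (@le_trans _ _ (expR pi ^+ (N * Q))).
    apply: lerXn2r; rewrite ?nnegrE;
      [exact: addr_ge0 ler01 (pi_ge0 R)|exact: expR_ge0|exact: expR_ge1Dx].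
  rewrite -expRM_natl natrM (_ : N%:R * Q%:R * pi = N%:R * (pi * Q%:R))//; ring.
have h2 : 2 <= expR a :> R.
  by apply: le_trans (expR_ge1Dx a); lra.
apply: (@le_lt_trans _ _ (expR (N%:R * (pi * Q%:R)) * (expR a *
    expR (- (C0 * (pi * Q%:R + 2 * (1 + z)) + 2) * a)))).
  apply: ler_pM; [|exact: mulr_ge0 (ler0n _ 2) (expR_ge0 _)|exact: h1|].
    by apply: exprn_ge0; exact: addr_ge0 ler01 (pi_ge0 R).
  by apply: ler_wpM2r h2; exact: expR_ge0.
rewrite -!expRD ltr_expR.
have q0 : 0 <= pi * Q%:R + 2 * (1 + z) :> R.
  by rewrite addr_ge0 ?mulr_ge0 ?pi_ge0// addr_ge0.
have := ler_wpM2r q0 NC; rewrite mulrAC => h3; lra.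
Qed.

End mean_content_to_widim.

Section widim_of_mean_content.
Variables (R : realType) (d : nat) (X : topologicalType).
Hypotheses (X_neq0 : [set: X] !=set0) (X_compact : compact [set: X]).
Variables (T : 'rV[R]_d -> X -> X) (T_action : continuous_action T).
Variables (dist : X -> X -> R) (dist_compatible : compatible_metric dist).
Variables (rho : X -> X -> R) (rho_compatible : compatible_metric rho).
Variables (phi : X -> R) (phi_continuous : continuous phi).

Lemma potential_sum_close (L tau : R) x y : 0 < L ->
  (forall u, cube L u -> `|phi (T u x) - phi (T u y)| <= tau) ->
  potential_sum T phi L x <= potential_sum T phi L y + tau * L ^+ d.
Proof.
move=> L0 close; rewrite !potential_sumE -(box_integral_cst 0 tau L0).
have cx := continuous_act_time T_action (x := x) phi_continuous.
have cy := continuous_act_time T_action (x := y) phi_continuous.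
rewrite -box_integralD//; last exact: cst_continuous.
have cs : continuous (fun u => phi (T u y) + tau).
  by move=> u; exact: (cvgD (cy u) (cvg_cst tau)).
apply: le_Rintegral.
- exact: measurable_row_box.
- exact: (integrable_box 0 L0 cx).
- exact: (integrable_box 0 L0 cs).
move=> t tb; rewrite -lerBlDl; apply: ler_normlW; apply: close => i.
by have := tb i; rewrite !mxE add0r.
Qed.

(** All constants up to [delta] are fixed before L; afterwards L enters through the number of cells,
    which is O(L^d), matching the exponent [tau * L ^+ d] of [delta]. *)
Lemma widim_le_of_mean_content (e tau : R) : 0 < e -> 0 < tau ->
  exists2 delta : R, 0 < delta & forall L s : R, 1 <= L ->
    sup (range (potential_sum T phi L)) < s ->
    (hausdorff_content s delta (dist_mean T dist L) (potential_sum T phi L) <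
      1)%E ->
    (widim e (dist_sup T rho L) (potential_sum T phi L) <= (s + 3 * (tau * L ^+
      d))%:E)%E.
Proof.
move=> e0 tau0; have [x0 _] := X_neq0.
have [r1 r1_gt0 rho_r1] : exists2 r, 0 < r & forall x y, dist x y < r ->
  rho x y < e / 2.
  apply: (dist_uniform dist_compatible X_compact (h := fun p => rho p.1 p.2)).
  - by rewrite divr_gt0.
  - exact: continuous_dist.
  - by move=> x; exact: dist_refl.
have [r2 r2_gt0 phi_r2] : exists2 r, 0 < r & forall x y, dist x y < r ->
  `|phi x - phi y| < tau.
  apply: (dist_uniform dist_compatible X_compact (h := fun p => `|phi p.1 - phi
    p.2|)) => //.
    move=> [x y]; apply: (cvg_norm (_ : (fun p => phi p.1 - phi p.2) @ (x,
      y) --> phi x - phi y)).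
    apply: cvgB.
      by apply: (@continuous_comp (X * X)%type X R fst phi (x, y));
        [exact: cvg_fst|exact: phi_continuous].
    by apply: (@continuous_comp (X * X)%type X R snd phi (x, y));
      [exact: cvg_snd|exact: phi_continuous].
  by move=> x; rewrite subrr normr0.
have e20 : 0 <= e / 2 by lra.
have e2e : e / 2 < e by lra.
have [r [r0 rr1 rr2]] : exists r, [/\ 0 < r, r <= r1 & r <= r2].
  by exists (Num.min r1 r2); rewrite lt_min r1_gt0 r2_gt0 !ge_min !lexx orbT.
(* This is the bound of [cell_average_close] with [om = zeta]. *)
have [zeta [zeta0 zetar]] : exists zeta, 0 < zeta /\ 4 * zeta + 5 * zeta < r.
  by exists (r / 10); split; lra.
have [M [p net]] := finite_net dist_compatible X_compact zeta0.
have [eta0 eta0_gt0 mod] := act_modulus X_compact T_action dist_compatible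
  zeta0.
have [B dB] := compatible_metric_bounded X_compact dist_compatible.
have B0 : 0 <= B by apply: le_trans (dB x0 x0); exact: dist_ge0.
have [Bphi _ phiB] := compact_bounded_fun X_compact phi_continuous.
pose Q := (Num.truncn (B / zeta)).+1.
(* The number of cells per side is at most L / eta0 + 1, hence at most (1 / eta0 + 1) L as L >=
   1. *)
pose C0 := M%:R * (eta0^-1 + 1) ^+ d.
have C0_ge0 : 0 <= C0 by rewrite mulr_ge0// exprn_ge0// addr_ge0// invr_ge0 ltW.
pose delta := expR (- (C0 * (pi * Q%:R + 2 * (1 + zeta^-1)) + 2) / tau).
exists delta; first exact: expR_gt0.
move=> L s L1 psi_s cost.
have L0 : 0 < L by exact: lt_le_trans L1.
have Ld1 : 1 <= L ^+ d by rewrite exprn_ege1.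
pose K := (Num.truncn (L / eta0)).+1.
have K0 : 0 < K%:R :> R by rewrite ltr0n.
have eta_lt : L / K%:R < eta0.
  by rewrite ltr_pdivrMr// mulrC -ltr_pdivrMr// truncnS_gt.
have KL : K%:R <= (eta0^-1 + 1) * L.
  rewrite mulrDl mul1r /K -natr1; apply: lerD => //.
  by rewrite [leRHS]mulrC truncn_le// divr_ge0 ?ltW.
pose J : finType := ({ffun 'I_d -> 'I_K} * 'I_M)%type.
have cardJ : #|J|%:R <= C0 * L ^+ d.
  rewrite /J card_prod card_ffun !card_ord natrM natrX mulrC /C0 -mulrA
    ler_wpM2l//.
  by rewrite -exprMn lerXn2r// nnegrE ?mulr_ge0 ?addr_ge0 ?invr_ge0// ltW.
have z0 : 0 <= zeta^-1 by rewrite invr_ge0 ltW.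
have Dmean_ge0 x y : 0 <= dist_mean T dist L x y by exact: dist_mean_ge0.
have Dmean_le x y : dist_mean T dist L x y <= B by exact: dist_mean_le.
have Dmean_cont x : continuous (dist_mean T dist L x) by exact:
  continuous_dist_mean.
have psi_cont : continuous (potential_sum T phi L) by exact:
  continuous_potential_sum.
have psi_le x : potential_sum T phi L x <= Bphi * L ^+ d.
  by apply: le_trans (ler_norm _) _; exact: potential_sum_bound.
pose F : J -> X -> R := cell_average T dist L zeta p.
have C_ge0 : 0 <= #|J|%:R / zeta by rewrite mulr_ge0.
have F_cont j : continuous (F j) by exact: continuous_cell_average.
have F_ran j x : 0 <= F j x <= 2 * Q%:R - 1.
  rewrite (cell_average_ge0 T dist_compatible p L0 zeta0 (ltn0Sn _))/=.
  apply: le_trans (cell_average_le T_action dist_compatible dB p L0 zeta0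
    (ltn0Sn _) _ _) _.
  have : B / zeta < Q%:R by exact: truncnS_gt.
  have : 1 <= Q%:R :> R by rewrite ler1n.
  lra.
have F_lip := cell_average_lip T_action dist_compatible p L0 zeta0 (ltn0Sn _ :
  (0 < K)%N).
have delta01 : 0 < delta <= 1.
  rewrite expR_gt0 /delta -[leRHS]expR0 ler_expR mulNr oppr_le0 divr_ge0 ?(ltW
    tau0)//.
  by rewrite addr_ge0// mulr_ge0// addr_ge0// mulr_ge0// ?pi_ge0// addr_ge0.
have m0 : 0 < tau * L ^+ d by rewrite mulr_gt0// (lt_le_trans ltr01).
have small : (1 + pi) ^+ (#|J| * Q) * (2 * delta `^ (tau * L ^+ d)) <
    expR (- (2 * (#|J|%:R + #|J|%:R / zeta))) by exact: exp_smallness.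
apply: (widim_le_of_content X_compact Dmean_ge0 Dmean_le Dmean_cont psi_cont
  psi_le
  C_ge0 F_cont F_ran F_lip x0 delta01 m0 e20 e2e psi_s cost small).
move=> x y close.
have near u : cube L u -> dist (T u x) (T u y) < r.
  move=> cu; apply: le_lt_trans zetar.
  apply: (cell_average_close T_action dist_compatible L0 zeta0 (ltn0Sn _) _ _
    close cu).
    by move=> v vK z; apply/ltW/mod => i; exact: le_lt_trans (vK i) eta_lt.
  by move=> z; have [i /ltW zi] := net z; exists i.
split.
  by apply: dist_sup_le => // u /near/lt_le_trans/(_ rr1)/rho_r1/ltW.
by apply: potential_sum_close => // u /near/lt_le_trans/(_ rr2)/phi_r2/ltW.
Qed.

End widim_of_mean_content.

Theorem theorem3p4 (R : realType) (d : nat) (d_gt0 : (0 < d)%N)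
    (X : topologicalType) (X_neq0 : [set: X] !=set0)
    (X_compact : compact [set: X])
    (T : 'rV[R]_d -> X -> X) (T_action : continuous_action T)
    (dist : X -> X -> R) (dist_compatible : compatible_metric dist)
    (rho : X -> X -> R) (rho_compatible : compatible_metric rho)
    (phi : X -> R) (phi_continuous : continuous phi) :
  (mdim T rho phi <= lower_L1_mdimH T dist phi)%E.
Proof.
have [Bphi _ phiB] := compact_bounded_fun X_compact phi_continuous.
have [B rhoB] := compatible_metric_bounded X_compact rho_compatible.
apply: (mdim_le X_neq0 T_action phi_continuous phiB (dist_ge0 rho_compatible)
  rhoB) => e e0.
set I := ereal_inf _; set D := lower_L1_mdimH _ _ _.
have IleS (s : R) : (D < s%:E)%E -> (I <= s%:E)%E.
  move=> Ds; apply/lee_addgt0Pr => g g0.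
  (* The error is [3 * tau * L ^+ d], whence tau = g / 3. The lower limit then supplies some L >= 1
     at this [delta]. *)
  have [delta delta0 bound] := widim_le_of_mean_content X_neq0 X_compact
    T_action
    dist_compatible rho_compatible phi_continuous e0 (divr_gt0 g0 (ltr0Sn R 2)).
  have [L L1] := limf_einf_lt 1 (le_lt_trans (lower_L1_mdimH_ge T phi dist
    delta0) Ds).
  have L0 : 0 < L by exact: lt_le_trans L1.
  have Ld : 0 < L ^+ d by rewrite exprn_gt0.
  rewrite lte_pdivrMr// -EFinM => /ereal_inf_lt[_ [s' [psis' cost] <-]].
  rewrite lte_fin => s'L.
  apply: (@le_trans _ _ (widim_density T phi rho e L)).
    by apply: ereal_inf_lbound; exists L.
  rewrite /widim_density lee_pdivrMr// -EFinD -EFinM.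
  apply: le_trans (bound L s' L1 psis' cost) _; rewrite lee_fin.
  have -> : 3 * (g / 3 * L ^+ d) = g * L ^+ d by field.
  by rewrite mulrDl lerD2r ltW.
(* If [D] is [-oo], then [I] lies below every real number. *)
case DE : D IleS => [D0||] IleS; last first.
- move: (I) IleS => [i||] IleS //; last by have := IleS 0 (ltNyr _).
  by have := IleS (i - 1) (ltNyr _); rewrite lee_fin => ?; exfalso; lra.
- by rewrite leey.
apply/lee_addgt0Pr => g g0; rewrite -EFinD; apply: IleS.
by rewrite lte_fin ltrDl.
Qed.
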